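(* Let $\xi$ be a nonnegative random variable with all moments $\mathbf{E}[\xi^k]$, $k=1,2,\ldots$, finite and with distribution function $F$, where $F$ is absolutely continuous with density $f>0$ on $\mathbb{R}^+=[0,\infty)$. Write $\overline{F}(x)=1-F(x)$. Assume further that: (i) $f(x)$ is decreasing in $x\ge 0$; and (ii) there exist two constants $x_0\ge 1$ and $A>0$ such that $$\frac{f(x)}{\overline{F}(x)}\ge \frac{A}{x}\quad\text{for } x\ge x_0,$$ and some constants $B>0$, $\alpha>0$, $\beta>0$ and a real $\gamma$ such that $$\overline{F}(x)\ge B x^{\gamma}e^{-\alpha x^{\beta}}\quad\text{for } x\ge x_0.$$ For an integer $n\ge 1$ let $Y_n=\xi_1\xi_2\cdots\xi_n$, where $\xi_1,\ldots,\xi_n$ are independent copies of $\xi$. Then, for $n>2\beta$, the product $Y_n$ has a finite Krein quantity and is M-indet.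
   Context: For a nonnegative random variable with density $g$ on $(0,\infty)$, its Krein quantity is $$\mathbf{K}[g]=\int_0^{\infty}\frac{-\log g(x^2)}{1+x^2}\,dx.$$ A nonnegative random variable with all moments finite is called M-det (moment determinate, in the sense of the Stieltjes moment problem) if its distribution is the only probability distribution on $[0,\infty)$ having its moment sequence; otherwise it is called M-indet (moment indeterminate). *)

(* Defs.v *)
From HB Require Import structures.
From mathcomp Require Import all_boot all_order all_algebra.
From mathcomp Require Import all_classical all_reals all_analysis.

Set Implicit Arguments.
Unset Strict Implicit.
Unset Printing Implicit Defensive.

Import Order.TTheory GRing.Theory Num.Theory.
Import numFieldNormedType.Exports.

Local Open Scope classical_set_scope.
Local Open Scope ring_scope.

(* Nonnegativity is almost sure: the law is carried by [0, +oo[. *)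
Definition nonneg_rv (R : realType) (d : measure_display)
    (T : measurableType d) (P : probability T R) (X : {RV P >-> R}) : Prop :=
  distribution P X (`[0, +oo[ : set R) = 1%E.

Definition finite_moments (R : realType) (d : measure_display)
    (T : measurableType d) (P : probability T R) (X : {RV P >-> R}) : Prop :=
  forall k : nat, P.-integrable [set: T] (fun t => (X t ^+ k)%:E).

(* The law of X is carried by ]0, +oo[ and has density g there; the values of
   g outside ]0, +oo[ are irrelevant. *)
Definition is_density (R : realType) (d : measure_display)
    (T : measurableType d) (P : probability T R) (X : {RV P >-> R})
    (g : R -> R) : Prop :=
  [/\ measurable_fun (`]0, +oo[ : set R) g,
      (forall x, 0 < x -> 0 <= g x) &
      forall A : set R, measurable A ->
        distribution P X A =
        (\int[lebesgue_measure]_(x in A `&` `]0%R, +oo[) (g x)%:E)%E].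

(* The extended logarithm [lne] is used because [ln 0 = 0], whereas a density
   vanishing on a set of positive measure must give +oo. *)
Definition krein (R : realType) (g : R -> R) : \bar R :=
  (\int[lebesgue_measure]_(x in `]0%R, +oo[)
     (- lne (g (x ^+ 2))%:E * ((1 + x ^+ 2)^-1)%:E))%E.

(* An extended integral is the difference of the integrals of the positive and
   negative parts, with +oo - +oo = -oo, so it is a [fin_num] only if both
   parts have a finite integral.  A density is only determined almost
   everywhere; finiteness is required of every version. *)
Definition finite_krein (R : realType) (d : measure_display)
    (T : measurableType d) (P : probability T R) (X : {RV P >-> R}) : Prop :=
  (exists g : R -> R, is_density X g) /\
  (forall g : R -> R, is_density X g -> krein g \is a fin_num).

Definition Mdet (R : realType) (d : measure_display)
    (T : measurableType d) (P : probability T R) (X : {RV P >-> R}) : Prop :=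
  forall nu : probability R R,
    nu `[0%R, +oo[%classic = 1%E ->
    (forall k : nat,
       (\int[nu]_x (x ^+ k)%:E = 'E_P[(fun t => (X t ^+ k)%R)])%E) ->
    forall A : set R, measurable A -> nu A = distribution P X A.

Definition Mindet (R : realType) (d : measure_display)
    (T : measurableType d) (P : probability T R) (X : {RV P >-> R}) : Prop :=
  [/\ nonneg_rv X, finite_moments X & ~ Mdet X].

Definition mutually_independent (R : realType) (d : measure_display)
    (T : measurableType d) (P : probability T R) (n : nat)
    (X : 'I_n -> {RV P >-> R}) : Prop :=
  forall (J : {set 'I_n}) (A : 'I_n -> set R),
    (forall i, measurable (A i)) ->
    P (\bigcap_(i in [set` J]) (X i @^-1` A i)) =
    (\prod_(i in J) P (X i @^-1` A i))%E.

(* Laws are compared on Borel sets only: [distribution] is a function on all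
   subsets of R. *)
Definition same_law (R : realType) (d d' : measure_display)
    (T : measurableType d) (T' : measurableType d')
    (P : probability T R) (P' : probability T' R)
    (X : {RV P >-> R}) (X' : {RV P' >-> R}) : Prop :=
  forall A : set R, measurable A -> distribution P X A = distribution P' X' A.

Definition tail (R : realType) (d : measure_display)
    (T : measurableType d) (P : probability T R) (X : {RV P >-> R})
    (x : R) : R :=
  1 - fine (cdf X x).

Definition prod_rv (R : realType) (d : measure_display)
    (T : measurableType d) (P : probability T R) (n : nat)
    (X : 'I_n -> {RV P >-> R}) : T -> R :=
  fun t => \prod_(i < n) X i t.

Lemma measurable_prod_rv (R : realType) (d : measure_display)
    (T : measurableType d) (P : probability T R) (n : nat)
    (X : 'I_n -> {RV P >-> R}) :
  measurable_fun [set: T] (prod_rv X).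
Proof. by apply: measurable_prod => i _; exact: measurable_funPT. Qed.

HB.instance Definition _ (R : realType) (d : measure_display)
    (T : measurableType d) (P : probability T R) (n : nat)
    (X : 'I_n -> {RV P >-> R}) :=
  isMeasurableFun.Build d default_measure_display T R (prod_rv X)
    (measurable_prod_rv X).

(* Main.v *)
Require Import Defs.
From HB Require Import structures.
From mathcomp Require Import all_boot all_order all_algebra.
From mathcomp Require Import all_classical all_reals all_analysis.
From mathcomp Require Import measurable_realfun.
From mathcomp Require Import ring lra.

Set Implicit Arguments.
Unset Strict Implicit.
Unset Printing Implicit Defensive.

Import Order.TTheory GRing.Theory Num.Theory.
Import numFieldNormedType.Exports.

Local Open Scope classical_set_scope.
Local Open Scope ring_scope.

(** Put rho = beta / n, so that 0 < rho < 1/2. The argument compares the density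
of the product with the stretched exponential exp(- a x^rho).

The hazard bound turns the lower bound on the tail into one on the density, and
the powers of x are absorbed by the exponential; by monotonicity
f x >= c exp(- a x^beta) for all x > 0 ([stretched_exp_density_lb]).

By independence the law of the product is an iterated multiplicative
convolution ([law_prod]), and its density at w is
g w = E[f (w / U) / U], where U is the product of n - 1 of the factors
([mconv_pos_density]). A decreasing probability density satisfies v f v <= 1,
whence g w <= 1 / w. Conversely, put w = t^n: each factor lies in [t, 2t] with
probability at least t f (2t), and if those of U all do then w / U <= t and
U <= (2t)^(n-1). This gives g w >= c exp(- a w^rho)
([mpow_stretched_exp_lb]): the exponent beta has been divided by n.

Finiteness of the Krein quantity follows: |ln (g (x^2))| is at most
a constant times 1 + x^(2 rho) + x^(-1/2), which is integrable against
1 / (1 + x^2) because 2 rho < 1 ([krein_fin_num]). Another version of the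
density differs from g on a null set only, and the inverse image of a null set
under squaring is null ([ae_pos_sqr]).

For the indeterminacy, the lower bound on g leaves room for the perturbation
found by Stieltjes. The function
h x = exp(- p x^rho) sin (q x^rho), where p + i q has argument pi rho, has all
its moments equal to zero: the integral of x^k exp(- z x^rho) over the half-line
is a real multiple of z^(- (k+1) / rho), which is real at z = p + i q
([stieltjes_perturbation]). As pi rho < pi / 2, the modulus of p + i q can be
chosen so that p >= a; then c |h| <= g, and g + c h is the density of a second
law with the same moments ([stretched_exp_density_not_unique]). *)

(** * Measures given by a density *)

(** The proofs that g is measurable and nonnegative are arguments, so that the
measure structure can be inferred from the term. *)
Definition mdensity d (T : measurableType d) (R : realType)
    (mu : {measure set T -> \bar R}) (g : T -> R)
    (mg : measurable_fun [set: T] g) (g0 : forall x, 0 <= g x) :=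
  fun A : set T => (\int[mu]_(x in A) (g x)%:E)%E.

Section mdensity_measure.
Local Open Scope ereal_scope.
Context d (T : measurableType d) (R : realType).
Variables (mu : {measure set T -> \bar R}) (g : T -> R).
Hypotheses (mg : measurable_fun [set: T] g) (g0 : forall x, (0 <= g x)%R).

Let mdensity0 : mdensity mu mg g0 set0 = 0.
Proof. by rewrite /mdensity integral_set0. Qed.

Let mdensity_ge0 A : 0 <= mdensity mu mg g0 A.
Proof. by apply: integral_ge0 => x _; rewrite lee_fin. Qed.

Let mdensity_sigma_additive : semi_sigma_additive (mdensity mu mg g0).
Proof.
move=> F mF tF mUF; rewrite /mdensity; apply: cvg_toP.
  apply: ereal_nondecreasing_is_cvgn => m n mn.
  apply: lee_sum_nneg_natr => // k _ _; apply: integral_ge0 => x _.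
  by rewrite lee_fin.
rewrite ge0_integral_bigcup//=.
- by apply/measurable_EFinP; apply: measurable_funS mg.
- by move=> x _; rewrite lee_fin.
Qed.

HB.instance Definition _ := isMeasure.Build _ _ _
  (mdensity mu mg g0) mdensity0 mdensity_ge0 mdensity_sigma_additive.

End mdensity_measure.

Section density.
Import HBNNSimple.
Local Open Scope ereal_scope.

(** By monotone convergence it is enough to treat a simple function h, where the
claim is the hypothesis on each of its level sets. *)
Lemma ge0_integral_density d (T : measurableType d) (R : realType)
    (mu nu : {measure set T -> \bar R}) (g : T -> R) (h : T -> \bar R) :
  measurable_fun [set: T] g -> (forall x, 0 <= g x)%R ->
  (forall A, measurable A -> nu A = \int[mu]_(x in A) (g x)%:E) ->
  measurable_fun [set: T] h -> (forall x, 0 <= h x) ->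
  \int[nu]_x h x = \int[mu]_x (h x * (g x)%:E).
Proof.
move=> mg g0 nuE mh h0.
have mgE : measurable_fun setT (EFin \o g) by exact/measurable_EFinP.
pose hn := nnsfun_approx measurableT mh.
have mhn n : measurable_fun setT (EFin \o (hn n : T -> R)) by exact/measurable_EFinP.
have ndhn x : nondecreasing_seq (fun n => (hn n x)%:E).
  by move=> a b ab; rewrite lee_fin; exact/lefP/nd_nnsfun_approx.
have cvgh x : (hn n x)%:E @[n --> \oo] --> h x.
  exact: cvg_nnsfun_approx.
have hE x : h x = limn (fun n => (hn n x)%:E) by exact/esym/cvg_lim.
have hgE x : h x * (g x)%:E = limn (fun n => (hn n x)%:E * (g x)%:E).
  by apply/esym/cvg_lim => //; apply: cvgeZr => //; exact: cvgh.
under eq_integral do rewrite hE.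
under [RHS]eq_integral do rewrite hgE.
rewrite monotone_convergence//; last by move=> n x _; rewrite lee_fin.
rewrite monotone_convergence//; last 3 first.
- by move=> n; apply: emeasurable_funM; [exact: mhn|exact: mgE].
- by move=> n x _ /=; rewrite mule_ge0 ?lee_fin.
- move=> x _ a b ab/=; rewrite lee_wpmul2r ?lee_fin//.
  exact/lefP/nd_nnsfun_approx.
congr (limn _); apply/funext => n.
rewrite integralT_nnsfun sintegralE.
have indicE x : ((hn n x)%:E * (g x)%:E) =
    \sum_(y \in range (hn n)) (y * \1_(hn n @^-1` [set y]) x)%:E * (g x)%:E.
  rewrite -ge0_mule_fsuml => [|y]; last exact: nnfun_muleindic_ge0.
  by rewrite fsumEFin// -(fimfunE _ x).
under [RHS]eq_integral do rewrite indicE.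
rewrite ge0_integral_fsum//; last 2 first.
- move=> y; apply: emeasurable_funM => //.
  by apply/measurable_EFinP; exact: measurable_funM.
- move=> m y _; apply: mule_ge0; last by rewrite lee_fin.
  exact: nnfun_muleindic_ge0.
apply: eq_fsbigr => r /set_mem [t _ <-].
under [RHS]eq_integral do rewrite EFinM -muleA.
rewrite ge0_integralZl//.
- congr (_ * _); under eq_integral do rewrite muleC.
  rewrite (eq_integral ((EFin \o g) \_ (hn n @^-1` [set hn n t]))); last first.
    by move=> x xE; rewrite epatch_indic.
  by rewrite -integral_mkcond -nuE.
- by apply: emeasurable_funM => //; exact/measurable_EFinP.
- by move=> x _; rewrite mule_ge0// lee_fin.
- by rewrite lee_fin.
Qed.

End density.

(** * Change of variables on the positive half-line *)

Section substitution.
Context {R : realType}.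
Local Notation mu := (@lebesgue_measure R).

(** As h is only measurable, the formula is derived from an equality of two
measures: the image under phi of the measure with density phi', and Lebesgue
measure, both on the positive half-line. By uniqueness they need to be compared
on the sets ]-oo, x[ only, where the fundamental theorem of calculus applies.
The function psi is the inverse of phi on the half-line. *)
Lemma ge0_integral_pos_subst (phi phi' psi : R -> R) (h : R -> \bar R) :
  (forall x : R, is_derive x (1 : R) phi (phi' x)) -> continuous phi' ->
  (forall x : R, 0 <= x -> 0 <= phi' x) ->
  phi 0 = 0 ->
  (forall x y : R, 0 <= x -> 0 < y -> (phi x < y) = (x < psi y)) ->
  (forall y : R, 0 < y -> phi (psi y) = y) ->
  (forall x : R, 0 < x -> 0 < phi x) ->
  measurable_fun [set: R] h -> (forall y, 0 <= h y)%E ->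
  (\int[mu]_(y in `]0%R, +oo[) h y =
   \int[mu]_(x in `]0%R, +oo[) (h (phi x) * (phi' x)%:E))%E.
Proof.
move=> dphi cphi' phi'0 phi0 phipsi psiK phi_gt0 mh h0.
have cphi : continuous phi.
  move=> x; apply: differentiable_continuous.
  by apply/derivable1_diffP; have := dphi x; move=> -[].
have mphi : measurable_fun [set: R] phi by exact: continuous_measurable_fun.
have mphi' : measurable_fun [set: R] phi' by exact: continuous_measurable_fun.
have mD : measurable (`]0%R, +oo[%classic : set R) by [].
pose w := phi' \_ `]0, +oo[.
have mw : measurable_fun [set: R] w.
  by apply/(measurable_restrictT _ _).1 => //; exact: measurable_funS mphi'.
have w0 x : 0 <= w x.
  rewrite /w patchE; case: ifPn => // /set_mem/=; rewrite in_itv/= andbT => x0.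
  exact/phi'0/ltW.
pose push : {measure set (measurableTypeR R) -> \bar R} :=
  pushforward (mdensity mu mw w0) (phi : measurableTypeR R -> measurableTypeR R).
pose m1 := push mphi.
pose m2 : {measure set (measurableTypeR R) -> \bar R} := mrestr mu mD.
have psi0 y : 0 < y -> 0 < psi y by move=> y0; rewrite -phipsi// phi0.
have m1E x : m1 `]-oo, x[%classic = (Num.max x 0)%:E.
  have -> : m1 `]-oo, x[%classic =
      (\int[mu]_(t in phi @^-1` `]-oo, x[ `&` `]0%R, +oo[) (phi' t)%:E)%E.
    by rewrite /m1/push/= /pushforward/= /mdensity integral_mkcondr;
      apply: eq_integral => t _; rewrite restrict_EFin.
  have [x0|x0] := leP x 0.
    rewrite (_ : _ `&` _ = set0) ?integral_set0//.
    rewrite -subset0 => t /=; rewrite !in_itv/= andbT => -[tx t0].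
    by have := phi_gt0 _ t0; rewrite ltNge (le_trans (ltW tx)).
  rewrite (_ : _ `&` _ = `]0, psi x[%classic); last first.
    apply/seteqP; split => t /=; rewrite !in_itv/= andbT.
      by move=> [tx t0]; rewrite t0 -phipsi ?ltW.
    by move=> /andP[t0 tx]; rewrite phipsi ?ltW.
  rewrite -(@integral_itv_bndoo _ _ _ _ true false); last first.
    by apply/measurable_EFinP; exact: measurable_funS mphi'.
  rewrite (continuous_FTC2 (F := phi)) ?psi0//.
  - by rewrite psiK// phi0 sube0.
  - exact: continuous_subspaceT.
  - split.
    + by move=> y _; have := dphi y; move=> -[].
    + by apply: cvg_at_right_filter; exact: cphi.
    + by apply: cvg_at_left_filter; exact: cphi.
  - by move=> y _; rewrite derive1E; exact: derive_val.
have m2E x : m2 `]-oo, x[%classic = (Num.max x 0)%:E.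
  rewrite /m2/= /mrestr/=.
  rewrite (_ : _ `&` _ = `]0, x[%classic); last first.
    apply/seteqP; split => t /=; rewrite !in_itv/= andbT.
      by move=> [-> ->].
    by move=> /andP[-> ->].
  rewrite lebesgue_measure_itv/= lte_fin.
  by have [x0|x0] := ltP 0 x; rewrite -?EFinD ?subr0.
have m12 (A : set (measurableTypeR R)) : measurable A -> m1 A = m2 A.
  apply: (@measure_unique _ R (measurableTypeR R) (@RGenInftyO.G R)
    (fun k => `]-oo, k%:R[%classic) _ _ _ _ m1 m2).
  - exact: RGenInftyO.measurableE.
  - move=> _ _ [x ->] [y ->]; exists (Num.min x y).
    apply/seteqP; split => t /=; rewrite !in_itv/= lt_min.
      by move=> [-> ->].
    by move=> /andP[].
  - by move=> k; exists k%:R.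
  - apply/seteqP; split => // t _.
    exists (Num.trunc `|t|).+1 => //=; rewrite in_itv/=.
    by rewrite (le_lt_trans (ler_norm _))// truncnS_gt.
  - by move=> _ [x ->]; rewrite m1E m2E.
  - by move=> k; rewrite m1E ltry.
transitivity (\int[m2]_y h y)%E.
  rewrite (ge0_integral_density (mu := mu) (g := \1_(`]0%R, +oo[)))//.
  - rewrite [LHS]integral_mkcond; apply: eq_integral => t _.
    rewrite patchE indicE; case: (t \in _); by rewrite ?mule1 ?mule0.
  - by move=> A mA; rewrite integral_indic// setIC.
transitivity (\int[m1]_y h y)%E.
  by apply: eq_measure_integral => A mA _; rewrite m12.
rewrite ge0_integral_pushforward// preimage_setT.
rewrite (ge0_integral_density (mu := mu) (g := w))//; last 2 first.
- exact: (measurableT_comp mh mphi).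
- by move=> t; exact: h0.
rewrite [RHS]integral_mkcond; apply: eq_integral => t _ /=.
by rewrite /w !patchE; case: ifP; rewrite ?mule0.
Qed.

End substitution.

Section substitution_instances.
Context {R : realType}.
Local Notation mu := (@lebesgue_measure R).

Lemma ge0_integral_pos_scale (u : R) (h : R -> \bar R) : 0 < u ->
  measurable_fun [set: R] h -> (forall y, 0 <= h y)%E ->
  (\int[mu]_(y in `]0%R, +oo[) h y =
   \int[mu]_(x in `]0%R, +oo[) (h (u * x)%R * u%:E))%E.
Proof.
move=> u0 mh h0.
apply: (ge0_integral_pos_subst (phi := fun x => u * x) (phi' := fun=> u)
  (psi := fun y => y / u)) => //.
- by move=> x; apply: is_derive_eq; rewrite /GRing.scale/= mulr1.
- by move=> x; exact: cvg_cst.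
- by move=> x _; exact: ltW.
- by rewrite mulr0.
- by move=> x y x0 y0; rewrite ltr_pdivlMr// mulrC.
- by move=> y y0; rewrite mulrC divfK// gt_eqF.
- by move=> x x0; rewrite mulr_gt0.
Qed.

Lemma ge0_integral_pos_sqr (h : R -> \bar R) :
  measurable_fun [set: R] h -> (forall y, 0 <= h y)%E ->
  (\int[mu]_(y in `]0%R, +oo[) h y =
   \int[mu]_(x in `]0%R, +oo[) (h (x ^+ 2)%R * (2 * x)%:E))%E.
Proof.
move=> mh h0.
apply: (ge0_integral_pos_subst (phi := fun x : R => x ^+ 2)
  (phi' := fun x => 2 * x) (psi := Num.sqrt)) => //.
- move=> x; apply: is_derive_eq; rewrite /GRing.scale/=.
  by rewrite mulr1 mulr_natl mulr2n.
- by move=> x; apply: cvgM; [exact: cvg_cst|exact: cvg_id].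
- by move=> x x0; rewrite mulr_ge0.
- by rewrite expr0n.
- move=> x y x0 y0.
  by rewrite -[X in _ = (X < _)]ger0_norm// -sqrtr_sqr ltr_sqrt.
- by move=> y y0; rewrite sqr_sqrtr// ltW.
- by move=> x x0; rewrite exprn_gt0.
Qed.

(** Change of variables in the integral of the indicator of a null set N: the
integral of the indicator of N at x^2 with weight 2 x vanishes, and the weight
is positive. *)
Lemma ae_pos_sqr (Q : R -> Prop) :
  {ae mu, forall y, 0 < y -> Q y} -> {ae mu, forall x, 0 < x -> Q (x ^+ 2)}.
Proof.
move=> [N [mN N0 QN]].
have mN1 : measurable_fun [set: R] (fun x => (\1_N x)%:E : \bar R).
  by apply/measurable_EFinP; exact: measurable_indic.
have mN2 : measurable_fun (`]0%R, +oo[%classic : set R)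
    (fun x => (\1_N (x ^+ 2))%:E * (2 * x)%:E)%E.
  apply: measurable_funTS; apply: emeasurable_funM.
    apply/measurable_EFinP.
    apply: (measurableT_comp (f := \1_N : R -> R)) => //.
  by apply/measurable_EFinP; exact: measurable_funM.
have : (\int[mu]_(x in `]0%R, +oo[)
    ((\1_N (x ^+ 2)%R)%:E * (2 * x)%:E) = 0)%E.
  rewrite -(ge0_integral_pos_sqr mN1); last by move=> y; rewrite lee_fin.
  rewrite integral_indic//; apply/eqP; rewrite eq_le measure_ge0 andbT -N0.
  by apply: le_measure => //; rewrite ?inE//; exact: measurableI.
move=> I0.
have : (\int[mu]_(x in `]0%R, +oo[)
    `|(\1_N (x ^+ 2)%R)%:E * (2 * x)%:E| = 0)%E.
  rewrite -[RHS]I0; apply: eq_integral => x /set_mem/=.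
  rewrite in_itv/= andbT => x0.
  by rewrite -EFinM ger0_norm// mulr_ge0// mulr_ge0// ltW.
move=> I1; have := (ae_eq_integral_abs mu (measurable_itv _) mN2).1 I1.
apply: filterS => x /= h x0; apply: contrapT => Qx.
have {h} : ((\1_N (x ^+ 2))%:E * (2 * x)%:E = 0 :> \bar R)%E.
  by apply: h; rewrite in_itv/= x0.
rewrite indicE mem_set ?mul1e => [/eqP|].
  by rewrite eqe mulf_eq0 pnatr_eq0/= gt_eqF.
by apply: QN => /= /(_ (exprn_gt0 _ x0)).
Qed.

End substitution_instances.

(** * Density of a product of two independent variables *)

Lemma integral_cst_probability d (T : measurableType d) (R : realType)
    (P : probability T R) (r : R) : (\int[P]_x r%:E = r%:E)%E.
Proof.
rewrite integral_cst// -[RHS]mule1; congr (_ * _)%E.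
exact: probability_setT.
Qed.

Lemma ge0_integral_full d (T : measurableType d) (R : realType)
    (P : probability T R) (D : set T) (h : T -> \bar R) :
  measurable D -> P D = 1%E -> measurable_fun [set: T] h ->
  (forall x, 0 <= h x)%E -> (\int[P]_x h x = \int[P]_(x in D) h x)%E.
Proof.
move=> mD PD mh h0.
have PDC : P (~` D) = 0%E by rewrite probability_setC// PD subee.
rewrite (@ge0_negligible_integral _ _ _ P setT (~` D))//; last exact: measurableC.
by rewrite setTD setCK.
Qed.

Section multiplicative_convolution.
Context {R : realType}.
Local Notation mu := (@lebesgue_measure R).

(** The formula 1 / x = x (x^2)^(-1), which also holds at 0 with the
convention 0^-1 = 0, reduces the claim to power functions. *)
Lemma measurable_invr : measurable_fun [set: R] (@GRing.inv R).
Proof.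
rewrite (_ : GRing.inv = fun x : R => x * (x ^+ 2) `^ (-1)); last first.
  apply/funext => x; rewrite powR_inv1 ?sqr_ge0//.
  have [->|x0] := eqVneq x 0; first by rewrite invr0 mul0r.
  by rewrite expr2 invfM mulrA divff// mul1r.
apply: measurable_funM => //.
by apply: (measurableT_comp (measurable_powR _)); exact: measurable_funX.
Qed.

Definition mulRR (z : R * R) : R := z.1 * z.2.

Lemma measurable_mulRR : measurable_fun [set: R * R] mulRR.
Proof. by apply: measurable_funM. Qed.

HB.instance Definition _ :=
  isMeasurableFun.Build _ _ _ _ mulRR measurable_mulRR.

(** The law of u v for independent u and v with laws m1 and m2. *)
Definition mconv (m1 m2 : probability R R) : probability R R :=
  distribution (m1 \x m2)%E mulRR.

Lemma mconvE (m1 m2 : probability R R) (A : set R) :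
  mconv m1 m2 A = (m1 \x m2)%E (mulRR @^-1` A).
Proof. by []. Qed.

Lemma ge0_integral_mconv (m1 m2 : probability R R) (h : R -> \bar R) :
  measurable_fun [set: R] h -> (forall y, 0 <= h y)%E ->
  (\int[mconv m1 m2]_y h y = \int[m1]_u \int[m2]_v h (u * v)%R)%E.
Proof.
move=> mh h0; rewrite ge0_integral_pushforward// preimage_setT fubini_tonelli1//.
- by apply: measurableT_comp => //; exact: measurable_mulRR.
- by move=> z; exact: h0.
Qed.

(** The conditions of [is_density], for a measure instead of a random variable;
for the law of a random variable the two are convertible. *)
Definition pos_density (m : set R -> \bar R) (g : R -> R) :=
  [/\ measurable_fun (`]0, +oo[ : set R) g,
      (forall x, 0 < x -> 0 <= g x) &
      forall A : set R, measurable A ->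
        m A = (\int[mu]_(x in A `&` `]0%R, +oo[) (g x)%:E)%E].

Lemma pos_densityT (m : set R -> \bar R) (g : R -> R) :
  pos_density m g ->
  [/\ measurable_fun [set: R] (g \_ `]0, +oo[),
      (forall x, 0 <= (g \_ `]0, +oo[) x) &
      forall A : set R, measurable A ->
        m A = (\int[mu]_(x in A) ((g \_ `]0%R, +oo[) x)%:E)%E].
Proof.
move=> [mg g0 mE]; split.
- by apply/(measurable_restrictT _ _).1.
- move=> x; rewrite patchE; case: ifPn => // /set_mem/=.
  by rewrite in_itv/= andbT; exact: g0.
- move=> A mA; rewrite mE// integral_mkcondr; apply: eq_integral => x _.
  by rewrite restrict_EFin.
Qed.

Lemma ge0_integral_pos_density (m : {measure set R -> \bar R}) (g : R -> R)
    (h : R -> \bar R) :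
  pos_density m g -> measurable_fun [set: R] h -> (forall y, 0 <= h y)%E ->
  (\int[m]_y h y = \int[mu]_(y in `]0%R, +oo[) (h y * (g y)%:E))%E.
Proof.
move=> /pos_densityT[mg g0 mE] mh h0.
(* R and measurableTypeR R have the same measurable sets; the image under the
   identity transports m from one structure to the other. *)
pose cast : {measure set (measurableTypeR R) -> \bar R} :=
  pushforward m (idfun : R -> measurableTypeR R).
have mid : measurable_fun [set: R] (idfun : R -> measurableTypeR R).
  by move=> _ A mA; rewrite setTI.
have -> : (\int[m]_y h y = \int[cast mid]_y h y)%E.
  by rewrite [RHS](ge0_integral_pushforward mid)// => y _; exact: h0.
rewrite (ge0_integral_density (mu := mu) (nu := cast mid) mg g0 mE mh h0).
rewrite [RHS]integral_mkcond; apply: eq_integral => x _.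
by rewrite !patchE; case: ifPn => //; rewrite mule0.
Qed.

(** The expectation of f (w / u) / u for u with law m. For w > 0 the extension of
f by zero removes the values u <= 0, and the integral is finite when v f v is
bounded, so that [fine] loses nothing. *)
Definition mconv_density (m : probability R R) (f : R -> R) (w : R) : R :=
  fine (\int[m]_u ((f \_ `]0, +oo[) (w / u) / u)%:E)%E.

Section mconv_density.
Variables (m1 m2 : probability R R) (f : R -> R).
Hypotheses (fd : pos_density m2 f) (fub : forall v, 0 < v -> v * f v <= 1).
Let f0 := f \_ `]0, +oo[.
Let k (w u : R) := f0 (w / u) / u.

Let mk : measurable_fun [set: R * R] (fun z : R * R => k z.2 z.1).
Proof.
have [mf0 _ _] := pos_densityT fd.
have mi : measurable_fun [set: R * R] (fun z : R * R => z.1^-1).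
  exact: (measurableT_comp measurable_invr).
apply: measurable_funM => //.
by apply: (measurableT_comp mf0); exact: measurable_funM.
Qed.

Lemma measurable_mconv_kernel w :
  measurable_fun [set: R] (fun u => f0 (w / u) / u).
Proof. by have := measurableT_comp mk (measurable_pair2 w). Qed.

Lemma mconv_kernelN w u : 0 < w -> u <= 0 -> f0 (w / u) / u = 0.
Proof.
move=> w0 u0; rewrite /f0 patchE; case: ifPn => [/set_mem/=|]; last by rewrite mul0r.
by rewrite in_itv/= andbT pmulr_rgt0// invr_gt0 ltNge u0.
Qed.

Lemma mconv_kernelP w u : 0 < w -> 0 < u -> f0 (w / u) / u = f (w / u) / u.
Proof.
by move=> w0 u0; rewrite /f0 patchE mem_set//= in_itv/= andbT divr_gt0.
Qed.

Lemma mconv_kernel_ge0 w u : 0 < w -> 0 <= f0 (w / u) / u.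
Proof.
move=> w0; have [u0|u0] := leP u 0; first by rewrite mconv_kernelN.
have [_ f_ge0 _] := fd.
rewrite mconv_kernelP//; apply: divr_ge0; last exact: ltW.
by apply: f_ge0; exact: divr_gt0.
Qed.

(** The kernel is 1 / w times the value of v f v at v = w / u. *)
Lemma mconv_kernel_le w u : 0 < w -> f0 (w / u) / u <= w^-1.
Proof.
move=> w0; have [u0|u0] := leP u 0; first by rewrite mconv_kernelN// invr_ge0 ltW.
rewrite mconv_kernelP// -[leRHS]mul1r ler_pdivlMr// mulrC mulrA mulrAC.
by rewrite fub// divr_gt0.
Qed.

Lemma mconv_densityE w : 0 < w ->
  (mconv_density m1 f w)%:E = (\int[m1]_u (f0 (w / u) / u)%:E)%E.
Proof.
move=> w0; rewrite /mconv_density fineK// ge0_fin_numE; last first.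
  by apply: integral_ge0 => u _; rewrite lee_fin mconv_kernel_ge0.
apply: (@le_lt_trans _ _ (\int[m1]_u (w^-1)%:E)%E).
  apply: ge0_le_integral => //.
  - by move=> u _; rewrite lee_fin mconv_kernel_ge0.
  - by apply/measurable_EFinP; exact: measurable_mconv_kernel.
  - by move=> u _; rewrite lee_fin mconv_kernel_le.
by rewrite integral_cst_probability ltry.
Qed.

Lemma mconv_density_le w : 0 < w -> mconv_density m1 f w <= w^-1.
Proof.
move=> w0; rewrite -lee_fin mconv_densityE//.
apply: (@le_trans _ _ (\int[m1]_u (w^-1)%:E)%E).
  apply: ge0_le_integral => //.
  - by move=> u _; rewrite lee_fin mconv_kernel_ge0.
  - by apply/measurable_EFinP; exact: measurable_mconv_kernel.
  - by move=> u _; rewrite lee_fin mconv_kernel_le.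
by rewrite integral_cst_probability.
Qed.

(** Integrate over v first, substitute v = w / u for fixed u > 0, and exchange the
two integrals. *)
Lemma mconv_pos_density : m1 `]0, +oo[%classic = 1%E ->
  pos_density (mconv m1 m2) (mconv_density m1 f).
Proof.
move=> m1D; split.
- apply/measurable_EFinP.
  apply: (eq_measurable_fun (fun w => \int[m1]_u (`|k w u|%:E))%E) => [w|].
    rewrite inE/= in_itv/= andbT => w0; rewrite mconv_densityE//.
    by apply: eq_integral => u _; rewrite ger0_norm// mconv_kernel_ge0.
  apply: measurable_funTS.
  apply: (measurable_fun_fubini_tonelli_G (m1 := m1)
    (fun z : R * R => (`|k z.2 z.1|%:E))).
  + by apply/measurable_EFinP; apply: measurableT_comp.
  + by move=> z; rewrite lee_fin.
- by move=> w w0; rewrite -lee_fin mconv_densityE//; apply: integral_ge0 => u _;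
    rewrite lee_fin mconv_kernel_ge0.
move=> A mA.
have mAE : measurable_fun [set: R] (fun x => (\1_A x)%:E : \bar R).
  by apply/measurable_EFinP; exact: measurable_indic.
pose K (z : R * measurableTypeR R) : \bar R :=
  ((\1_(A `&` `]0%R, +oo[) z.2)%:E * `|k z.2 z.1|%:E)%E.
have K0 z : (0 <= K z)%E by rewrite mule_ge0// lee_fin.
have mS : measurable (A `&` `]0%R, +oo[%classic) by exact: measurableI.
have mK : measurable_fun [set: R * measurableTypeR R] K.
  apply: emeasurable_funM; apply/measurable_EFinP.
    exact: (measurableT_comp (measurable_indic mS) measurable_snd).
  exact: (measurableT_comp (@normr_measurable _ _) mk).
have -> : mconv m1 m2 A = (\int[m1]_u \int[mu]_w K (u, w))%E.
  transitivity (\int[mconv m1 m2]_y (\1_A y)%:E)%E.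
    by rewrite integral_indic// setIT.
  rewrite ge0_integral_mconv//.
  transitivity (\int[m1]_(u in `]0%R, +oo[) \int[m2]_v (\1_A (u * v))%:E)%E.
    apply: ge0_integral_full => //.
      apply: (measurable_fun_fubini_tonelli_F (m2 := m2)
        (fun z : R * R => (\1_A (mulRR z))%:E)) => //.
      by apply: (measurableT_comp mAE); exact: measurable_mulRR.
    by move=> u; apply: integral_ge0 => v _; rewrite lee_fin.
  transitivity (\int[m1]_(u in `]0%R, +oo[) \int[mu]_w K (u, w))%E; last first.
    apply/esym/ge0_integral_full => //.
      exact: (measurable_fun_fubini_tonelli_F (m2 := mu) K).
    by move=> u; apply: integral_ge0.
  apply: eq_integral => u /set_mem/=; rewrite in_itv/= andbT => u0.
  rewrite (ge0_integral_pos_density fd)//; last first.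
    by apply: (measurableT_comp mAE); exact: measurable_funM.
  transitivity (\int[mu]_(w in `]0%R, +oo[) ((\1_A w)%:E * `|k w u|%:E))%E.
    rewrite [RHS](ge0_integral_pos_scale u0); last 2 first.
    - apply: emeasurable_funM => //; apply/measurable_EFinP.
      exact: (measurableT_comp (measurableT_comp (@normr_measurable R setT) mk)
        (measurable_pair1 u)).
    - by move=> y; rewrite mule_ge0// lee_fin.
    apply: eq_integral => v /set_mem/=; rewrite in_itv/= andbT => v0.
    rewrite -muleA; congr (_ * _)%E; rewrite -EFinM; congr EFin.
    rewrite /k mconv_kernelP ?mulr_gt0// ger0_norm; last first.
      have [_ f_ge0 _] := fd.
      by rewrite divr_ge0 ?(ltW u0)// f_ge0// divr_gt0// mulr_gt0.
    by rewrite divfK ?gt_eqF// (mulrC u) mulfK// gt_eqF.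
  rewrite integral_mkcond; apply: eq_integral => w _.
  rewrite /K/= patchE !indicE in_setI; case: ifPn => _.
    by rewrite andbT.
  by rewrite andbF mul0e.
rewrite fubini_tonelli// [RHS]integral_mkcond; apply: eq_integral => w _.
rewrite patchE; case: ifPn => [wS|wS].
  have /= := set_mem wS; rewrite in_itv/= andbT => -[_ w0].
  rewrite mconv_densityE//; apply: eq_integral => u _.
  by rewrite /K/= indicE wS mul1e ger0_norm// mconv_kernel_ge0.
by rewrite integral0_eq// => u _; rewrite /K/= indicE (negbTE wS) mul0e.
Qed.

End mconv_density.
End multiplicative_convolution.

(** * Powers for the multiplicative convolution *)

Section multiplicative_power.
Context {R : realType}.
Local Notation mu := (@lebesgue_measure R).

(** The law of a product of n independent variables with law nu; the empty product
is 1. *)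
Fixpoint mpow (nu : probability R R) (n : nat) : probability R R :=
  if n is n'.+1 then mconv (mpow nu n') nu else @dirac _ R (1 : R) R.

Lemma le_mconv (m1 m2 : probability R R) (A B C : set R) :
  measurable A -> measurable B -> measurable C ->
  (forall u v, A u -> B v -> C (u * v)) -> (m1 A * m2 B <= mconv m1 m2 C)%E.
Proof.
move=> mA mB mC ABC; rewrite mconvE -product_measure1E//.
apply: le_measure; rewrite ?inE//.
- exact: measurableX.
- by rewrite -[X in measurable X]setTI; exact: measurable_mulRR.
- by move=> [u v] /= [Au Bv]; exact: ABC.
Qed.

Lemma mpow_pos (nu : probability R R) n : nu `]0, +oo[%classic = 1%E ->
  mpow nu n `]0, +oo[%classic = 1%E.
Proof.
move=> nuD; elim: n => [|n IHn].
  by rewrite /= diracE mem_set//= in_itv/= ltr01.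
apply/eqP; rewrite eq_le probability_le1//=.
have := @le_mconv (mpow nu n) nu `]0, +oo[ `]0, +oo[ `]0, +oo[.
rewrite IHn nuD mule1; apply => // u v /=.
by rewrite !in_itv/= !andbT; exact: mulr_gt0.
Qed.

(** The product lies in [a^n, b^n] as soon as every factor lies in [a, b]. *)
Lemma mpow_itv (nu : probability R R) n (a b p : R) :
  0 <= a -> 0 <= p -> (p%:E <= nu `[a%R, b%R]%classic)%E ->
  ((p ^+ n)%:E <= mpow nu n `[(a ^+ n)%R, (b ^+ n)%R]%classic)%E.
Proof.
move=> a0 p0 pnu; elim: n => [|n IHn].
  by rewrite !expr0 /= diracE mem_set//= in_itv/= lexx.
have := @le_mconv (mpow nu n) nu `[a ^+ n, b ^+ n]%classic `[a, b]%classic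
  `[a ^+ n.+1, b ^+ n.+1]%classic.
move=> h; apply: le_trans (h _ _ _ _) => //.
  by rewrite exprSr EFinM lee_pmul// lee_fin// exprn_ge0.
move=> u v /=; rewrite !in_itv/= => /andP[au ub] /andP[av vb].
have u0 : 0 <= u by rewrite (le_trans _ au)// exprn_ge0.
by rewrite !exprSr !ler_pM ?exprn_ge0//; exact: le_trans av.
Qed.

(** Absolute moments are multiplicative under [mconv], by exchange of integrals. *)
Lemma mpow_moment (nu : probability R R) k n :
  (\int[nu]_v (`|v| ^+ k)%:E < +oo)%E ->
  (\int[mpow nu n]_y (`|y| ^+ k)%:E < +oo)%E.
Proof.
have mk : measurable_fun [set: R] (fun y : R => (`|y| ^+ k)%:E : \bar R).
  by apply/measurable_EFinP; apply: measurable_funX; exact: normr_measurable.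
move=> nuk; elim: n => [|n IHn].
  by rewrite /= integral_dirac// diracT mul1e ltry.
rewrite /= ge0_integral_mconv//.
pose c := (\int[nu]_v (`|v| ^+ k)%:E)%E.
have c0 : (0 <= c)%E by apply: integral_ge0 => v _; rewrite lee_fin exprn_ge0.
have cfin : c \is a fin_num by rewrite ge0_fin_numE.
under eq_integral => u _.
  under eq_integral do rewrite normrM exprMn EFinM.
  rewrite ge0_integralZl//.
  over.
rewrite /= -/c -(fineK cfin) ge0_integralZr//; last by rewrite lee_fin fine_ge0.
by rewrite lte_mul_pinfty ?ltry// ?ge0_fin_numE//;
  apply: integral_ge0 => v _; rewrite lee_fin exprn_ge0.
Qed.

(** For u in [t^n, (2t)^n] and w = t^(n+1) one has w / u <= t, hence
f (w / u) >= f t, and 1 / u >= (2t)^(-n). The lower end t^n makes the first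
inequality hold, the upper end gives the second. *)
Lemma mconv_density_mpow_ge (nu : probability R R) (f : R -> R) n (t p : R) :
  pos_density nu f -> (forall v, 0 < v -> v * f v <= 1) ->
  (forall x y, 0 <= x -> x <= y -> f y <= f x) -> 0 < t -> 0 <= p ->
  (p%:E <= nu `[t%R, (2 * t)%R]%classic)%E ->
  f t / (2 * t) ^+ n * p ^+ n <=
  mconv_density (mpow nu n) f (t ^+ n.+1).
Proof.
move=> fd fub fdec t0 p0 pnu.
have tn0 : 0 < t ^+ n.+1 by rewrite exprn_gt0.
rewrite -lee_fin (mconv_densityE _ fd fub)//.
set S := `[t ^+ n, (2 * t) ^+ n]%classic.
have mS : measurable (S : set R) by exact: measurable_itv.
have ft0 : 0 <= f t by have [_ + _] := fd; exact.
have c0 : 0 <= f t / (2 * t) ^+ n.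
  by rewrite divr_ge0// exprn_ge0// mulr_ge0// ltW.
apply: (@le_trans _ _ (\int[mpow nu n]_u (f t / (2 * t) ^+ n * \1_S u)%:E)%E).
  under eq_integral do rewrite EFinM.
  rewrite ge0_integralZl//; last exact/measurable_EFinP/measurable_indic.
  rewrite integral_indic// setIT EFinM lee_wpmul2l//.
  by apply: mpow_itv => //; exact: ltW.
apply: ge0_le_integral => //.
- by move=> u _; rewrite lee_fin mulr_ge0.
- by apply/measurable_EFinP; exact: measurable_funM.
- by apply/measurable_EFinP; exact: (measurable_mconv_kernel fd).
- move=> u _; rewrite lee_fin indicE.
  have [/set_mem|uS] := boolP (u \in S); last first.
    by rewrite mulr0; exact: (mconv_kernel_ge0 fd).
  rewrite /S/= in_itv/= => /andP[tu ut].
  have u0 : 0 < u by rewrite (lt_le_trans _ tu)// exprn_gt0.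
  rewrite mulr1 (mconv_kernelP)// ler_pM//.
  + by rewrite invr_ge0 exprn_ge0// mulr_ge0// ltW.
  + apply: fdec; first by rewrite divr_ge0// ltW.
    by rewrite ler_pdivrMr// exprS ler_pM2l.
  + by rewrite lef_pV2// posrE exprn_gt0// mulr_gt0.
Qed.

End multiplicative_power.

(** * Law of a product of independent copies *)

Section product_law.
Context {R : realType} d (T : measurableType d) (P : probability T R).
Variables (n : nat) (X : 'I_n -> {RV P >-> R}) (nu : probability R R).
Hypothesis X_indep : mutually_independent X.
Hypothesis X_law :
  forall i (A : set R), measurable A -> distribution P (X i) A = nu A.

Let Y (m : nat) (t : T) : R := \prod_(i < n | (i < m)%N) X i t.

Let mY m : measurable_fun [set: T] (Y m).
Proof.
rewrite (_ : Y m = fun t => \prod_(i < n) (if (i < m)%N then X i t else 1)).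
  apply: measurable_prod => i _; case: (i < m)%N; last exact: measurable_cst.
  exact: (measurable_funPT (X i)).
by apply/funext => t; rewrite /Y big_mkcond.
Qed.

Let later (B : 'I_n -> set R) (m : nat) : set T :=
  \bigcap_(i in [set` [set i : 'I_n | (m <= i)%N]%SET]) (X i @^-1` B i).

Let mlater B m : (forall i, measurable (B i)) -> measurable (later B m).
Proof.
move=> mB; apply: fin_bigcap_measurable; first exact: finite_finset.
by move=> i _; exact: (measurable_funPTI (X i)).
Qed.

Let laterS (B : 'I_n -> set R) (i0 : 'I_n) :
  later B i0 = (X i0 @^-1` B i0) `&` later B i0.+1.
Proof.
apply/seteqP; split => [t Bt|t [Bt0 Bt] i /=].
  split; first by apply: (Bt i0); rewrite /= inE.
  by move=> i /=; rewrite inE => ni; apply: (Bt i); rewrite /= inE ltnW.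
rewrite inE leq_eqVlt => /predU1P[/val_inj <-//|ni].
by apply: (Bt i); rewrite /= inE.
Qed.

Let YS (i0 : 'I_n) t : Y i0.+1 t = Y i0 t * X i0 t.
Proof.
rewrite /Y (bigD1 i0)//= mulrC; congr (_ * _); apply: eq_bigl => i.
by rewrite ltnS ltn_neqAle andbC.
Qed.

(** The induction carries the events on the later factors along, because
independence is only given as a product rule for events. On the event E for the
factors after m, the joint law of the partial product and of the factor m is
identified on rectangles; uniqueness of the product measure extends this to
the inverse image of A under multiplication. *)
Lemma law_partial_prod m (A : set R) (B : 'I_n -> set R) : (m <= n)%N ->
  measurable A -> (forall i, measurable (B i)) ->
  (P (Y m @^-1` A `&` later B m) =
   mpow nu m A * \prod_(i < n | (m <= i)%N) nu (B i))%E.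
Proof.
elim: m A B => [|m IHm] A B mn mA mB.
  rewrite (_ : Y 0 = cst 1); last first.
    by apply/funext => t; rewrite /Y big_pred0.
  rewrite preimage_cst/= diracE; case: ifPn => A1; last by rewrite set0I measure0 mul0e.
  rewrite setTI mul1e X_indep//; apply: eq_big => i; first by rewrite inE.
  by move=> _; exact: X_law.
pose i0 := Ordinal mn.
pose E := later B m.+1.
have mE : measurable E by exact: mlater.
pose c := (\prod_(i < n | (m < i)%N) nu (B i))%E.
have c0 : (0 <= c)%E by apply: prode_ge0.
have cfin : c \is a fin_num.
  by apply: prode_fin_num => i _; exact: fin_num_measure.
have fc0 : 0 <= fine c by exact: fine_ge0.
pose k := NngNum fc0.
have mYX : measurable_fun [set: T] (fun t => (Y m t, X i0 t)).
  by apply/measurable_fun_pairP; split; [exact: mY|exact: (measurable_funPT (X i0))].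
pose push : {measure set (R * R) -> \bar R} :=
  pushforward (mrestr P mE) (fun t => (Y m t, X i0 t)).
have pushE A1 B1 : measurable A1 -> measurable B1 ->
    (push mYX (A1 `*` B1) = mpow nu m A1 * mscale k nu B1)%E.
  move=> mA1 mB1.
  pose B' (i : 'I_n) := if i == i0 then B1 else B i.
  have mB' i : measurable (B' i) by rewrite /B'; case: ifP.
  have B'E (i : 'I_n) : (m < i)%N -> B' i = B i.
    by rewrite /B'; case: eqP => // ->; rewrite ltnn.
  have -> : push mYX (A1 `*` B1) = P (Y m @^-1` A1 `&` later B' m).
    rewrite /push/= /pushforward/= /mrestr (laterS B' i0) /B' eqxx setIA.
    congr (P (_ `&` _)); apply: eq_bigcapr => i; rewrite /= inE => mi.
    by have := B'E i mi; rewrite /B' => ->.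
  rewrite (IHm _ _ (ltnW mn))//; congr (_ * _)%E.
  rewrite (bigD1 i0)//= /B' eqxx muleC /mscale/=; congr (_ * _)%E.
  rewrite fineK//; apply: eq_big => i.
    by rewrite ltn_neqAle andbC eq_sym.
  by rewrite andbC => /andP[/negbTE ->].
have -> : P (Y m.+1 @^-1` A `&` later B m.+1) = push mYX (mulRR @^-1` A).
  rewrite /push/= /pushforward/= /mrestr; congr (P (_ `&` _)).
  apply/seteqP; split => t /=; rewrite (YS i0).
    by [].
  by [].
have mS : measurable (mulRR @^-1` A).
  by rewrite -[X in measurable X]setTI; exact: measurable_mulRR.
rewrite -(product_measure_unique pushE)//.
rewrite (@product_measure_unique _ _ _ _ _ _ _ (mscale k (mpow nu m \x nu)%E))//.
  by rewrite /mscale muleC; congr (_ * _)%E; exact: fineK.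
move=> A1 B1 mA1 mB1; rewrite /mscale muleCA; congr (_ * _)%E.
exact: product_measure1E.
Qed.

Lemma law_prod (A : set R) : measurable A ->
  distribution P (prod_rv X) A = mpow nu n A.
Proof.
move=> mA; have := law_partial_prod (B := fun=> setT) (leqnn n) mA.
rewrite big_pred0; last by move=> i; rewrite leqNgt ltn_ord.
have -> : Y n = prod_rv X.
  by apply/funext => t; apply: eq_bigl => i; exact: ltn_ord.
have -> : later (fun=> setT) n = setT by apply/seteqP; split.
by rewrite setIT mule1; apply.
Qed.

End product_law.

(** * Stretched exponentials *)

Section stretched_exponential.
Context {R : realType}.
Local Notation mu := (@lebesgue_measure R).

Lemma continuous_powR_pos (s x : R) : 0 < x ->
  {for x, continuous (fun y : R => y `^ s)}.
Proof.
move=> x0; apply: differentiable_continuous; apply/derivable1_diffP.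
by have [] := is_derive1_powR s x0.
Qed.

(** For x >= 1, compare x^k with (x^rho)^M for an integer M >= k / rho, and use
exp y >= y^M / M!. *)
Lemma stretched_exp_bound (b rho : R) (k : nat) : 0 < b -> 0 < rho ->
  exists2 C, 0 <= C &
    forall x, 0 < x -> x ^+ k * expR (- (b * x `^ rho)) <= C.
Proof.
move=> b0 rho0; pose M := (Num.trunc (k%:R / rho)).+1.
have kM : k%:R <= rho * M%:R.
  by rewrite mulrC -ler_pdivrMr// ltW// truncnS_gt.
pose C := M`!%:R / b ^+ M.
have C0 : 0 <= C by rewrite divr_ge0// exprn_ge0// ltW.
exists (1 + C) => [|x x0]; first by rewrite addr_ge0.
have y0 : 0 <= b * x `^ rho by rewrite mulr_ge0 ?powR_ge0// ltW.
have [x1|x1] := leP x 1.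
  rewrite (@le_trans _ _ 1)// ?lerDl// mulr_ile1 ?expR_ge0 ?exprn_ge0 ?(ltW x0)//.
    by rewrite exprn_ile1// ltW.
  by rewrite -expR0 ler_expR oppr_le0.
rewrite (@le_trans _ _ C)// ?lerDr// expRN ler_pdivrMr ?expR_gt0//.
have xk : x ^+ k <= (x `^ rho) ^+ M.
  rewrite -powR_mulrn ?powR_ge0// -powRrM -powR_mulrn ?(ltW x0)//.
  by rewrite ler_powR// ltW.
rewrite (le_trans xk)//.
have -> : (x `^ rho) ^+ M = C * ((b * x `^ rho) ^+ M / M`!%:R).
  rewrite /C exprMn mulrACA [b ^+ M * _]mulrC; field.
  by rewrite expf_neq0 ?gt_eqF//= pnatr_eq0 -lt0n fact_gt0.
apply: ler_wpM2l => //.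
apply: le_trans (expR_ge1Dxn (Num.trunc (k%:R / rho)) y0).
by rewrite lerDr.
Qed.

Lemma measurable_powR_expR (k : nat) (b rho : R) :
  measurable_fun [set: R] (fun x => x ^+ k * expR (- (b * x `^ rho))).
Proof.
apply: measurable_funM; first exact: measurable_funX.
apply: (measurableT_comp (@measurable_expR R)).
apply: measurable_funN; by apply: measurable_funM.
Qed.

Lemma integrable_stretched_exp (b rho : R) (k : nat) : 0 < b -> 0 < rho ->
  mu.-integrable `]0, +oo[
    (fun x => (x ^+ k * expR (- (b * x `^ rho)))%:E).
Proof.
move=> b0 rho0.
have [C1 C10 HC1] := stretched_exp_bound k b0 rho0.
have [C2 C20 HC2] := stretched_exp_bound k.+2 b0 rho0.
pose V (x : R) := (oneDsqr x)^-1.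
have mV : measurable_fun [set: R] V.
  by apply: continuous_measurable_fun; exact: continuous_oneDsqrV.
have iV : mu.-integrable `]0, +oo[ (EFin \o V).
  apply: (@integrableS _ _ _ mu `[0%R, +oo[) => //.
    by apply: subset_itvr; rewrite bnd_simp.
  apply/integrableP; split.
    by apply/measurable_EFinP; exact: measurable_funTS.
  under eq_integral => x _.
    rewrite /= ger0_norm; last by rewrite invr_ge0 ltW// oneDsqr_gt0.
    over.
  by rewrite integral0y_oneDsqr ltry.
have mD : @measurable _ (measurableTypeR R) `]0%R, +oo[%classic.
  exact: measurable_itv.
have := integrableZl mD (C1 + C2) iV.
apply: le_integrable => //.
  by apply/measurable_EFinP; apply: measurable_funTS; exact: measurable_powR_expR.
move=> x /=; rewrite in_itv/= andbT => x0.
rewrite lee_fin ger0_norm ?mulr_ge0 ?expR_ge0 ?exprn_ge0 ?(ltW x0)//.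
rewrite (le_trans _ (ler_norm _))// ler_pdivlMr ?oneDsqr_gt0//.
rewrite /oneDsqr mulrDr mulr1 lerD// ?HC1//.
by rewrite mulrAC -exprD addn2 HC2.
Qed.

End stretched_exponential.

(** * Fundamental theorem of calculus on the open half-line *)

Section ftc_on_half_line.
Context {R : realType}.
Local Notation mu := (@lebesgue_measure R).

Lemma pos_continuous_FTC2 (G g : R -> R) (a b : R) :
  (forall x : R, 0 < x -> is_derive x (1 : R) G (g x)) ->
  (forall x : R, 0 < x -> {for x, continuous g}) -> 0 < a -> a < b ->
  (\int[mu]_(x in `[a, b]) (g x)%:E = (G b)%:E - (G a)%:E)%E.
Proof.
move=> dG cg a0 ab; apply: continuous_FTC2 => //.
- apply: continuous_in_subspaceT => x /set_mem/=; rewrite in_itv/= => /andP[ax _].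
  by apply: cg; exact: (lt_le_trans a0 ax).
- have cG x : 0 < x -> {for x, continuous G}.
    move=> x0; apply: differentiable_continuous; apply/derivable1_diffP.
    by have [] := dG _ x0.
  split.
  + move=> x; rewrite in_itv/= => /andP[ax _].
    by have [] := dG _ (lt_trans a0 ax).
  + by apply: cvg_at_right_filter; exact: cG.
  + by apply: cvg_at_left_filter; apply: cG; exact: (lt_trans a0 ab).
- move=> x; rewrite in_itv/= => /andP[ax _]; rewrite derive1E.
  by have [_ ->] := dG _ (lt_trans a0 ax).
Qed.

(** The two bounds on G make both boundary terms vanish in the limit: the integral
of g over [1/(n+2), n+2] is the difference of two values of G, each at most
C / (n+2) in modulus. *)
Lemma integral_pos_derive_eq0 (G g : R -> R) (C : R) :
  (forall x : R, 0 < x -> is_derive x (1 : R) G (g x)) ->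
  (forall x : R, 0 < x -> {for x, continuous g}) ->
  mu.-integrable `]0, +oo[ (EFin \o g) ->
  (forall x : R, 0 < x -> `|G x| <= C * x) ->
  (forall x : R, 0 < x -> `|G x| <= C / x) ->
  (\int[mu]_(x in `]0%R, +oo[) (g x)%:E = 0)%E.
Proof.
move=> dG cg ig G0 Gy.
pose a (n : nat) : R := n.+2%:R^-1.
pose b (n : nat) : R := n.+2%:R.
have a0 n : 0 < a n by rewrite invr_gt0.
have ab n : a n < b n.
  by rewrite (@lt_le_trans _ _ 1)// ?invf_lt1// ?ltr1n// ler1n.
pose S n : set R := `[a n, b n]%classic.
have mS n : measurable (S n) by exact: measurable_itv.
have SD n : S n `<=` `]0, +oo[%classic.
  move=> x /=; rewrite !in_itv/= andbT => /andP[ax _].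
  exact: (lt_le_trans (a0 n) ax).
have intS n : (\int[mu]_(x in S n) (g x)%:E = (G (b n))%:E - (G (a n))%:E)%E.
  exact: pos_continuous_FTC2.
have mg : measurable_fun (`]0%R, +oo[%classic : set (measurableTypeR R)) (EFin \o g).
  by case/integrableP : ig.
have mD : @measurable _ (measurableTypeR R) `]0%R, +oo[%classic.
  exact: measurable_itv.
pose g_ n := (fun x => (g x)%:E) \_ (S n).
have cvg1 : (\int[mu]_(x in `]0%R, +oo[) g_ n x @[n --> \oo] -->
    \int[mu]_(x in `]0%R, +oo[) (g x)%:E)%E.
  apply: (@dominated_cvg _ _ _ mu `]0%R, +oo[%classic mD g_ (EFin \o g)
    (fun x => `|(g x)%:E|%E)) => //.
  - move=> n; apply/measurable_restrict => //; first exact: mS.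
    apply: measurable_funS mg => //; exact: subIsetl.
  - move=> x Dx; have x0 : 0 < (x : R).
      by have /andP[] := Dx.
    apply: cvg_near_cst; near=> n.
    rewrite /g_ patchE mem_set// /S/= in_itv/= /a /b; apply/andP; split.
      rewrite invf_ple ?posrE//; apply: (@le_trans _ _ n%:R).
        by near: n; exact: nbhs_infty_ger.
      by rewrite ler_nat -addn2 leq_addr.
    apply: (@le_trans _ _ n%:R).
      by near: n; exact: nbhs_infty_ger.
    by rewrite ler_nat -addn2 leq_addr.
  - exact: integrable_abse.
  - move=> n x _; rewrite /g_ patchE; case: ifPn => // _.
    by rewrite abse0.
have cvg2 : (\int[mu]_(x in `]0%R, +oo[) g_ n x @[n --> \oo] --> 0)%E.
  have -> : (fun n => \int[mu]_(x in `]0%R, +oo[) g_ n x)%E =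
            (fun n => (G (b n) - G (a n))%:E).
    apply/funext => n; rewrite /g_ -integral_mkcondr setIidr//.
  apply: cvg_EFin; first exact: nearW.
  apply: norm_cvg0.
  have h : (C + C) * harmonic n.+1 @[n --> \oo] --> (0 : R).
    rewrite -(mulr0 (C + C)); apply: cvgM; first exact: cvg_cst.
    by have := @cvg_harmonic R; rewrite -(cvg_shiftS (@harmonic R)).
  apply: (@squeeze_cvgr _ _ _ _ (cst 0) _ _ _ _ _ h); last exact: cvg_cst.
  apply: nearW => n; rewrite /= normr_ge0/= mulrDl (le_trans (ler_normB _ _))//.
  rewrite lerD//; first by rewrite Gy// /b.
  by rewrite G0.
by rewrite (cvg_unique _ cvg1 cvg2).
Unshelve. all: by end_near. Qed.

(** The integrals over [1/(n+2), n+2] are bounded by 2 M, and they increase to the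
integral over the half-line; g may be unbounded near 0. *)
Lemma ge0_integrable_pos_derive (G g : R -> R) (M : R) :
  (forall x : R, 0 < x -> is_derive x (1 : R) G (g x)) ->
  (forall x : R, 0 < x -> {for x, continuous g}) ->
  (forall x : R, 0 < x -> 0 <= g x) ->
  (forall x : R, 0 < x -> `|G x| <= M) ->
  mu.-integrable `]0, +oo[ (EFin \o g).
Proof.
move=> dG cg g0 GM.
pose a (n : nat) : R := n.+2%:R^-1.
pose b (n : nat) : R := n.+2%:R.
have a0 n : 0 < a n by rewrite invr_gt0.
have ab n : a n < b n.
  by rewrite (@lt_le_trans _ _ 1)// ?invf_lt1// ?ltr1n// ler1n.
pose S n : set (measurableTypeR R) := `[a n, b n]%classic.
have mS n : measurable (S n) by exact: measurable_itv.
have SD n : S n `<=` `]0, +oo[%classic.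
  move=> x /=; rewrite !in_itv/= andbT => /andP[ax _].
  exact: (lt_le_trans (a0 n) ax).
have SE : \bigcup_n S n = `]0%R, +oo[%classic.
  apply/seteqP; split => [x [n _]|x]; first exact: SD.
  rewrite /= in_itv/= andbT => x0.
  pose N := Num.trunc (x + x^-1).
  have xN : x + x^-1 < N.+2%:R.
    by rewrite (lt_trans (truncnS_gt _))// ltr_nat.
  exists N => //; rewrite /S/= in_itv/=; apply/andP; split.
    rewrite invf_ple ?posrE// (le_trans _ (ltW xN))//.
    by rewrite lerDr ltW.
  by rewrite (le_trans _ (ltW xN))// lerDl invr_ge0 ltW.
have mg : measurable_fun (`]0%R, +oo[%classic : set (measurableTypeR R)) (EFin \o g).
  apply/measurable_EFinP.
  apply: open_continuous_measurable_fun; first exact: interval_open.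
  by move=> x /set_mem/= /andP[x0 _]; exact: cg.
apply/integrableP; split => //.
apply: (@le_lt_trans _ _ (M + M)%:E); last exact: ltry.
have -> : (\int[mu]_(x in `]0%R, +oo[) `|(EFin \o g) x| =
    \int[mu]_(x in `]0%R, +oo[) (g x)%:E)%E.
  by apply: eq_integral => x /set_mem/= /andP[x0 _]; rewrite ger0_norm// g0.
have ndS : nondecreasing_seq S.
  move=> m n mn; apply/subsetPset => x; rewrite /S/= !in_itv/= => /andP[ax xb].
  rewrite (le_trans _ ax)/=; last by rewrite lef_pV2 ?posrE// ler_nat.
  by rewrite (le_trans xb)// ler_nat.
have cvgS : (\int[mu]_(x in S n) (g x)%:E @[n --> \oo] -->
    \int[mu]_(x in `]0%R, +oo[) (g x)%:E)%E.
  rewrite -SE; apply: ge0_nondecreasing_set_cvg_integral => //.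
  - by move=> n; apply: measurable_funS mg => //; exact: SD.
  - by move=> n x /SD/andP[x0 _]; rewrite lee_fin g0.
rewrite -(cvg_lim _ cvgS)//; apply: lime_le; first exact: cvgP cvgS.
apply: nearW => n; rewrite /S (pos_continuous_FTC2 dG cg)// -EFinB lee_fin.
rewrite (le_trans (ler_norm _))// (le_trans (ler_normB _ _))//.
by rewrite lerD// GM// (lt_trans (a0 n)).
Qed.

End ftc_on_half_line.

(** * A signed density with vanishing moments *)

Section phase_rotation.
Context {R : realType}.
Local Notation mu := (@lebesgue_measure R).

(** Minus the imaginary part of x^k exp(i s theta) exp(- z x^rho), where
z = r exp(i theta) and s = (k+1) / rho. The integral of x^k exp(- z x^rho) over
the half-line is a real constant times z^(- s), so that the rotation by s theta
makes the integral independent of theta, and it vanishes at theta = 0. *)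
Definition phase (k : nat) (r rho theta x : R) : R :=
  x ^+ k * expR (- (r * cos theta * x `^ rho)) *
  sin (r * sin theta * x `^ rho - k.+1%:R / rho * theta).

Definition dphase (k : nat) (r rho theta x : R) : R :=
  x ^+ k * expR (- (r * cos theta * x `^ rho)) *
  (r * x `^ rho * (sin theta *
     sin (r * sin theta * x `^ rho - k.+1%:R / rho * theta) +
     cos theta * cos (r * sin theta * x `^ rho - k.+1%:R / rho * theta)) -
   k.+1%:R / rho * cos (r * sin theta * x `^ rho - k.+1%:R / rho * theta)).

Lemma is_derive_phase k r rho (theta x : R) :
  is_derive theta 1 (fun t => phase k r rho t x) (dphase k r rho theta x).
Proof.
rewrite /phase /dphase; set y := x `^ rho; set s := _ / rho; set c := x ^+ k.
have d1 : is_derive theta 1 (fun t => - (r * cos t * y)) (r * sin theta * y).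
  apply: is_derive_eq; rewrite /GRing.scale/=; ring.
have d2 : is_derive theta 1 (fun t => r * sin t * y - s * t)
    (r * cos theta * y - s).
  apply: is_derive_eq; rewrite /GRing.scale/=; ring.
have d3 : is_derive theta 1 (fun t => expR (- (r * cos t * y)))
    (expR (- (r * cos theta * y)) * (r * sin theta * y)).
  exact: (is_derive1_comp (is_derive_expR _) d1).
have d4 : is_derive theta 1 (fun t => sin (r * sin t * y - s * t))
    (cos (r * sin theta * y - s * theta) * (r * cos theta * y - s)).
  exact: (is_derive1_comp (is_derive_sin _) d2).
apply: is_derive_eq; rewrite /GRing.scale/=; ring.
Qed.

(** The real part of x^(k+1) exp(i s theta) exp(- z x^rho). Its derivative in x is
- rho times the derivative of [phase] in theta; as it vanishes at 0 and at
infinity, the integral of [phase] has derivative zero in theta. *)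
Definition phase_prim (k : nat) (r rho theta x : R) : R :=
  x ^+ k.+1 * expR (- (r * cos theta * x `^ rho)) *
  cos (r * sin theta * x `^ rho - k.+1%:R / rho * theta).

Lemma is_derive_phase_prim k (r rho theta x : R) : 0 < rho -> 0 < x ->
  is_derive x 1 (phase_prim k r rho theta) (- rho * dphase k r rho theta x).
Proof.
move=> rho0 x0; rewrite /phase_prim /dphase; set s := _ / rho.
set p := r * cos theta; set q := r * sin theta.
have d0 := is_derive1_powR rho x0.
have xrho : x * (rho * x `^ (rho - 1)) = rho * x `^ rho.
  by rewrite mulrCA mulr_powRB1// ltW.
have d1 : is_derive x 1 (fun t => - (p * t `^ rho)) (- (p * (rho * x `^ (rho - 1)))).
  by apply: is_derive_eq; rewrite /GRing.scale/=; ring.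
have d2 : is_derive x 1 (fun t => q * t `^ rho - s * theta)
    (q * (rho * x `^ (rho - 1))).
  by apply: is_derive_eq; rewrite /GRing.scale/=; ring.
have d3 : is_derive x 1 (fun t => expR (- (p * t `^ rho)))
    (expR (- (p * x `^ rho)) * - (p * (rho * x `^ (rho - 1)))).
  exact: (is_derive1_comp (is_derive_expR _) d1).
have d4 : is_derive x 1 (fun t => cos (q * t `^ rho - s * theta))
    (- sin (q * x `^ rho - s * theta) * (q * (rho * x `^ (rho - 1)))).
  exact: (is_derive1_comp (is_derive_cos _) d2).
have d5 : is_derive x 1 (fun t : R => t ^+ k.+1) (k.+1%:R * x ^+ k).
  rewrite (_ : (fun t : R => t ^+ k.+1) = id ^+ k.+1); last first.
    by apply/funext => t; rewrite exprfctE.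
  by apply: is_derive_eq; rewrite /GRing.scale/= mulr1.
apply: is_derive_eq; rewrite /GRing.scale/=.
set e := expR _; set c := cos (_ - _); set S := sin _.
have -> : k.+1%:R = rho * s by rewrite /s mulrC divfK// gt_eqF.
rewrite exprS.
transitivity (- (x ^+ k * e * (S * q + p * c) * (x * (rho * x `^ (rho - 1)))) +
   c * e * (rho * s * x ^+ k)); first by ring.
by rewrite xrho /p /q; ring.
Qed.

End phase_rotation.

Section phase_integral.
Context {R : realType}.
Local Notation mu := (@lebesgue_measure R).
Variables (k : nat) (r rho b : R).
Hypotheses (r0 : 0 <= r) (rho0 : 0 < rho) (rho1 : rho <= 1) (b0 : 0 < b).
Let s := k.+1%:R / rho.

Let s0 : 0 <= s. Proof. by rewrite divr_ge0// ltW. Qed.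

Lemma powR_le1D (x : R) : 0 < x -> x `^ rho <= 1 + x.
Proof.
move=> x0; have [x1|x1] := leP x 1.
  rewrite (@le_trans _ _ 1)// ?lerDl ?(ltW x0)//.
  by rewrite -(powRr0 x); apply: ger_powR; [rewrite x0 x1|exact: ltW].
by rewrite (@le_trans _ _ x)// ?lerDr// ler1_powR// ltW.
Qed.

(** A majorant of the derivative of [phase] in theta, uniform over the angles with
b <= r cos theta; the absolute values make it nonnegative on the whole line. *)
Definition phase_majorant (x : R) : R :=
  `|x| ^+ k * expR (- (b * `|x| `^ rho)) * (2 * r * (1 + `|x|) + s).

Lemma phase_majorant_ge0 x : 0 <= phase_majorant x.
Proof.
rewrite /phase_majorant mulr_ge0//.
by rewrite addr_ge0 ?s0// mulr_ge0 ?addr_ge0 ?mulr_ge0 ?r0.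
Qed.

Let mD : @measurable _ (measurableTypeR R) `]0%R, +oo[%classic.
Proof. exact: measurable_itv. Qed.

Lemma integrable_phase_majorant :
  mu.-integrable `]0, +oo[ (EFin \o phase_majorant).
Proof.
have i1 := integrableZl mD (2 * r + s) (integrable_stretched_exp k b0 rho0).
have i2 := integrableZl mD (2 * r) (integrable_stretched_exp k.+1 b0 rho0).
apply: eq_integrable (integrableD mD i1 i2) => // x /set_mem xD.
have x0 : 0 < (x : R) by have /andP[] := xD.
rewrite /= -!EFinM -EFinD; congr EFin; rewrite /phase_majorant gtr0_norm// exprSr; ring.
Qed.

Lemma phase_le (theta x : R) : 0 < x -> b <= r * cos theta ->
  `|phase k r rho theta x| <= x ^+ k * expR (- (b * x `^ rho)).
Proof.
move=> x0 bt; rewrite /phase !normrM.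
rewrite (ger0_norm (exprn_ge0 _ (ltW x0))) (ger0_norm (expR_ge0 _)).
rewrite -[leRHS]mulr1 ler_pM ?mulr_ge0 ?expR_ge0 ?exprn_ge0 ?(ltW x0)//.
  by rewrite ler_wpM2l ?exprn_ge0 ?(ltW x0)// ler_expR lerN2 ler_wpM2r ?powR_ge0.
by rewrite ler_norml sin_geN1 sin_le1.
Qed.

Lemma phase_prim_le (theta x : R) : 0 < x -> b <= r * cos theta ->
  `|phase_prim k r rho theta x| <= x ^+ k.+1 * expR (- (b * x `^ rho)).
Proof.
move=> x0 bt; rewrite /phase_prim !normrM.
rewrite (ger0_norm (exprn_ge0 _ (ltW x0))) (ger0_norm (expR_ge0 _)).
rewrite -[leRHS]mulr1 ler_pM ?mulr_ge0 ?expR_ge0 ?exprn_ge0 ?(ltW x0)//.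
  by rewrite ler_wpM2l ?exprn_ge0 ?(ltW x0)// ler_expR lerN2 ler_wpM2r ?powR_ge0.
by rewrite ler_norml cos_geN1 cos_le1.
Qed.

Lemma dphase_le (theta x : R) : 0 < x -> b <= r * cos theta ->
  `|dphase k r rho theta x| <= phase_majorant x.
Proof.
move=> x0 bt; rewrite /dphase !normrM /phase_majorant -/s.
rewrite (ger0_norm (exprn_ge0 _ (ltW x0))) (ger0_norm (expR_ge0 _)).
rewrite (gtr0_norm x0) ler_pM ?mulr_ge0 ?expR_ge0 ?exprn_ge0 ?(ltW x0)//.
  by rewrite ler_wpM2l ?exprn_ge0 ?(ltW x0)// ler_expR lerN2 ler_wpM2r ?powR_ge0.
have nc t : `|cos t : R| <= 1 by rewrite ler_norml cos_geN1 cos_le1.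
have ns t : `|sin t : R| <= 1 by rewrite ler_norml sin_geN1 sin_le1.
rewrite (le_trans (ler_normB _ _))// lerD//; last first.
  by rewrite normrM (ger0_norm s0) ler_piMr.
rewrite normrM ger0_norm ?mulr_ge0 ?powR_ge0//.
rewrite [leLHS]mulrC -[leRHS]mulrA ler_pM ?mulr_ge0 ?powR_ge0//.
  rewrite (le_trans (ler_normD _ _))// (_ : 2 = 1 + 1 :> R)// lerD//.
    by rewrite normrM mulr_ile1.
  by rewrite normrM mulr_ile1.
by rewrite ler_wpM2l// powR_le1D.
Qed.

Let continuous_affine_powR (q t x : R) : 0 < x ->
  {for x, continuous (fun y : R => q * y `^ rho - t)}.
Proof.
move=> x0; apply: cvgB; last exact: cvg_cst.
by apply: cvgM; [exact: cvg_cst|exact: continuous_powR_pos].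
Qed.

Let continuous_dphase (theta x : R) : 0 < x ->
  {for x, continuous (dphase k r rho theta)}.
Proof.
move=> x0; rewrite /dphase -/s.
have cs : {for x, continuous (fun y : R => sin (r * sin theta * y `^ rho - s * theta))}.
  by apply: continuous_comp; [exact: continuous_affine_powR|exact: continuous_sin].
have cc : {for x, continuous (fun y : R => cos (r * sin theta * y `^ rho - s * theta))}.
  by apply: continuous_comp; [exact: continuous_affine_powR|exact: continuous_cos].
apply: cvgM.
  apply: cvgM; first exact: exprn_continuous.
  apply: (@continuous_comp _ _ _ (fun y : R => - (r * cos theta * y `^ rho)) expR).
    by apply: cvgN; apply: cvgM; [exact: cvg_cst|exact: continuous_powR_pos].
  exact: continuous_expR.
apply: cvgB; last by apply: cvgM; [exact: cvg_cst|exact: cc].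
apply: cvgM.
  by apply: cvgM; [exact: cvg_cst|exact: continuous_powR_pos].
by apply: cvgD; apply: cvgM; [exact: cvg_cst|exact: cs|exact: cvg_cst|exact: cc].
Qed.

Let measurable_dphase theta : measurable_fun (`]0, +oo[%classic : set R)
  (dphase k r rho theta).
Proof.
apply: open_continuous_measurable_fun; first exact: interval_open.
by move=> x /set_mem/= /andP[x0 _]; exact: continuous_dphase.
Qed.

Let integrable_dphase theta : b <= r * cos theta ->
  mu.-integrable `]0, +oo[ (EFin \o dphase k r rho theta).
Proof.
move=> bt; apply: le_integrable integrable_phase_majorant => //.
  by apply/measurable_EFinP; exact: measurable_dphase.
move=> x /= /andP[x0 _]; rewrite lee_fin (ger0_norm (phase_majorant_ge0 _)).
exact: dphase_le.
Qed.

Let measurable_phase theta : measurable_fun (`]0, +oo[%classic : set R)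
  (phase k r rho theta).
Proof.
apply: measurable_funTS; apply: measurable_funM.
  exact: measurable_powR_expR.
apply: (measurableT_comp (continuous_measurable_fun (@continuous_sin R))).
by apply: measurable_funB => //; apply: measurable_funM.
Qed.

Lemma integrable_phase theta : b <= r * cos theta ->
  mu.-integrable `]0, +oo[ (EFin \o phase k r rho theta).
Proof.
move=> bt; apply: le_integrable (integrable_stretched_exp k b0 rho0) => //.
  by apply/measurable_EFinP; exact: measurable_phase.
move=> x /= /andP[x0 _]; rewrite lee_fin.
by rewrite (le_trans (phase_le x0 bt))// ler_norm.
Qed.

(** The integrand is an x-derivative, up to the factor - rho. *)
Lemma integral_dphase_eq0 (theta : R) : b <= r * cos theta ->
  (\int[mu]_(x in `]0%R, +oo[) (dphase k r rho theta x)%:E = 0)%E.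
Proof.
move=> bt.
have [C1 C10 HC1] := stretched_exp_bound k b0 rho0.
have [C2 C20 HC2] := stretched_exp_bound k.+2 b0 rho0.
apply: (@integral_pos_derive_eq0 _
  (fun x => - rho^-1 * phase_prim k r rho theta x) _ (rho^-1 * (C1 + C2))).
- move=> x x0; have d := is_derive_phase_prim k r theta rho0 x0.
  apply: is_derive_eq; rewrite /GRing.scale/=.
  by rewrite mulrA mulrNN mulVf ?gt_eqF// mul1r.
- by move=> x x0; exact: continuous_dphase.
- exact: integrable_dphase.
- move=> x x0 /=; rewrite normrM normrN [X in X * _]gtr0_norm ?invr_gt0// -[leRHS]mulrA.
  rewrite ler_wpM2l ?invr_ge0 ?(ltW rho0)//.
  rewrite (le_trans (phase_prim_le x0 bt))// mulrDl ler_wpDr ?mulr_ge0 ?(ltW x0)//.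
  by rewrite exprSr mulrAC ler_wpM2r ?HC1// ltW.
- move=> x x0 /=; rewrite normrM normrN [X in X * _]gtr0_norm ?invr_gt0// -[leRHS]mulrA.
  rewrite ler_wpM2l ?invr_ge0 ?(ltW rho0)//.
  rewrite (le_trans (phase_prim_le x0 bt))// mulrDl.
  rewrite ler_wpDl ?mulr_ge0 ?invr_ge0 ?(ltW x0)//.
  by rewrite ler_pdivlMr// mulrAC -exprSr HC2.
Qed.

End phase_integral.

Section stieltjes_perturbation.
Context {R : realType}.
Local Notation mu := (@lebesgue_measure R).

Lemma cos_ge_itv (theta1 theta : R) : theta1 <= pi ->
  - theta1 <= theta <= theta1 -> cos theta1 <= cos theta.
Proof.
move=> t1pi /andP[t1 t2].
have nt : `|theta| <= theta1 by rewrite ler_norml t1 t2.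
have t10 : 0 <= theta1 by rewrite (le_trans _ nt).
rewrite -(cos_norm theta) leNgt ltr_cos -?leNgt// in_itv/=.
  by rewrite t10.
by rewrite normr_ge0 (le_trans nt).
Qed.

(** Differentiation under the integral sign on ]- theta1, theta1[: the derivative is
zero by [integral_dphase_eq0], and the value at 0 is zero because sin 0 = 0. *)
Lemma Rintegral_phase_eq0 k (r rho theta1 theta : R) :
  0 < r -> 0 < rho -> rho <= 1 -> theta1 < pi / 2 -> 0 < theta < theta1 ->
  (\int[mu]_(x in `]0%R, +oo[) phase k r rho theta x)%R = 0.
Proof.
move=> r0 rho0 rho1 t1pi /andP[t0 tt1].
pose b := r * cos theta1.
have t10 : 0 < theta1 by exact: (lt_trans t0 tt1).
have b0 : 0 < b.
  rewrite mulr_gt0// cos_gt0_pihalf// t1pi andbT (lt_trans _ t10)// oppr_lt0.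
  by rewrite divr_gt0 ?pi_gt0.
have bI (t : R) : `]- theta1, theta1[%classic t -> b <= r * cos t.
  rewrite /= in_itv/= => /andP[a1 a2]; rewrite ler_wpM2l ?(ltW r0)//.
  apply: cos_ge_itv; last by rewrite !ltW.
  by rewrite (le_trans (ltW t1pi))// ler_pdivrMr// ler_peMr ?pi_ge0// ler1n.
pose Phi t := (\int[mu]_(x in `]0%R, +oo[) phase k r rho t x)%R.
have mD : @measurable _ (measurableTypeR R) `]0%R, +oo[%classic.
  exact: measurable_itv.
have dPhi (t : R) : t \in `]- theta1, theta1[ -> is_derive t 1 Phi 0.
  move=> It.
  have intf (t' : R) : `]- theta1, theta1[%classic t' ->
      mu.-integrable `]0, +oo[ (EFin \o phase k r rho t').
    by move=> /bI bt; exact: integrable_phase bt.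
  have derf (t' x : R) : `]- theta1, theta1[%classic t' -> `]0%R, +oo[%classic x ->
      derivable ((phase k r rho) ^~ x) t' 1.
    by move=> _ _; have [] := is_derive_phase k r rho t' x.
  have d1E t' x : partial1of2 (phase k r rho) t' x = dphase k r rho t' x.
    by rewrite partial1of2E; have [_ ->] := is_derive_phase k r rho t' x.
  have G_ub (t' x : R) : `]- theta1, theta1[%classic t' -> `]0%R, +oo[%classic x ->
      `|partial1of2 (phase k r rho) t' x| <= phase_majorant k r rho b x.
    move=> /bI bt /andP[x0 _]; rewrite d1E.
    by apply: dphase_le bt => //; exact: ltW.
  have G0 x : 0 <= phase_majorant k r rho b x.
    by apply: phase_majorant_ge0 => //; exact: ltW.
  have iG : mu.-integrable `]0, +oo[ (EFin \o phase_majorant k r rho b).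
    exact: integrable_phase_majorant.
  apply: DeriveDef.
    exact: (derivable_under_integral mD It intf derf G0 iG G_ub).
  rewrite -derive1E (differentiation_under_integral mD It intf derf G0 iG G_ub).
  rewrite /Rintegral; under eq_integral do rewrite d1E.
  have I0 : (\int[mu]_(x in `]0%R, +oo[) (dphase k r rho t x)%:E = 0)%E.
    by apply: integral_dphase_eq0 (bI _ It) => //; exact: ltW.
  by rewrite I0.
have dPhi0 (x : R) : x \in `]0, theta[ -> is_derive x 1 Phi ((fun=> 0 : R) x).
  rewrite in_itv/= => /andP[x0 xt]; apply: dPhi.
  by rewrite in_itv/= (lt_trans _ x0) ?oppr_lt0// (lt_trans xt).
have cPhi : {within `[0, theta], continuous Phi}.
  apply: derivable_within_continuous => x; rewrite in_itv/= => /andP[x0 xt].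
  have h : x \in `]- theta1, theta1[.
    by rewrite in_itv/= (lt_le_trans _ x0) ?oppr_lt0// (le_lt_trans xt).
  by case: (dPhi x h).
have [c _] := MVT t0 dPhi0 cPhi.
rewrite mul0r => /eqP; rewrite subr_eq0 => /eqP; rewrite -/(Phi theta) => ->.
rewrite /Phi /Rintegral integral0_eq// => x _.
by rewrite /phase sin0 !(mulr0, mul0r) subr0 sin0 mulr0.
Qed.

Lemma sinB_natpi (y : R) n : sin (y - n%:R * pi) = (-1) ^+ n * sin y.
Proof.
elim: n => [|n IHn]; first by rewrite mul0r subr0 expr0 mul1r.
rewrite -natr1 mulrDl mul1r opprD addrA sinB cospi sinpi mulr0 subr0 IHn.
by rewrite exprS mulrN1 mulN1r mulNr.
Qed.

(** At theta = pi rho the phase shift (k+1) theta / rho is (k+1) pi, which only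
changes the sign of the sine. *)
Lemma stieltjes_perturbation (a rho : R) : 0 < a -> 0 < rho -> rho < 2^-1 ->
  exists p q : R, [/\ a <= p, 0 < q &
    forall k, (\int[mu]_(x in `]0%R, +oo[)
      (x ^+ k * (expR (- (p * x `^ rho)) * sin (q * x `^ rho)))%:E = 0)%E].
Proof.
move=> a0 rho0 rho12.
have pi0 := @pi_gt0 R.
pose theta : R := pi * rho.
pose theta1 : R := (theta + pi / 2) / 2.
have tpi : theta < pi / 2 by rewrite ltr_pM2l.
have [tt1 t1pi] := midf_lt tpi.
have t0 : 0 < theta by rewrite mulr_gt0.
have ct1 : 0 < cos theta1.
  apply: cos_gt0_pihalf; rewrite t1pi andbT (lt_trans _ (lt_trans t0 tt1))//.
  by rewrite oppr_lt0 divr_gt0.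
(* Any angle strictly between theta and pi / 2 would do for theta1; with this r,
   the decay rate r cos t is at least a for all angles t up to theta1. *)
pose r := a / cos theta1.
have r0 : 0 < r by rewrite divr_gt0.
have rho1 : rho <= 1 by rewrite (le_trans (ltW rho12))// invf_le1// ler1n.
have bt : r * cos theta1 <= r * cos theta.
  rewrite ler_wpM2l ?(ltW r0)//; apply: cos_ge_itv.
    by rewrite (le_trans (ltW t1pi))// ler_pdivrMr// ler_peMr ?ltW// ltr1n.
  rewrite (ltW tt1) andbT (le_trans _ (ltW t0))// oppr_le0 ltW//.
  exact: lt_trans tt1.
exists (r * cos theta), (r * sin theta); split.
- by rewrite -[leLHS](divfK (lt0r_neq0 ct1)).
- rewrite mulr_gt0// sin_gt0_pi// t0 (lt_trans tpi)//.
  by rewrite ltr_pdivrMr// ltr_pMr// ltr1n.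
move=> k.
have intp : mu.-integrable `]0, +oo[ (EFin \o phase k r rho theta).
  by apply: (@integrable_phase _ k r rho (r * cos theta1)) => //; rewrite mulr_gt0.
have phaseE x : phase k r rho theta x = (-1) ^+ k.+1 *
    (x ^+ k * (expR (- (r * cos theta * x `^ rho)) * sin (r * sin theta * x `^ rho))).
  rewrite /phase (_ : k.+1%:R / rho * theta = k.+1%:R * pi); last first.
    by rewrite /theta mulrA mulrAC divfK ?gt_eqF// mulrC.
  by rewrite sinB_natpi; ring.
have := @Rintegral_phase_eq0 k r rho theta1 theta r0 rho0 rho1 t1pi.
rewrite t0 tt1 => /(_ isT) I0.
have mD : @measurable _ (measurableTypeR R) `]0%R, +oo[%classic.
  exact: measurable_itv.
transitivity (\int[mu]_(x in `]0%R, +oo[)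
    (((-1) ^+ k.+1)%:E * (phase k r rho theta x)%:E))%E.
  apply: eq_integral => x _; rewrite -EFinM phaseE; congr EFin.
  rewrite [RHS]mulrA -exprMn.
  by rewrite mulrNN mulr1 expr1n mul1r.
rewrite integralZl// -[X in (_ * X)%E]fineK; last exact: integrable_fin_num.
by rewrite [fine _]I0 mule0.
Qed.

End stieltjes_perturbation.

(** * Lower bounds on densities *)

Section decreasing_density.
Context {R : realType}.
Local Notation mu := (@lebesgue_measure R).

(** For x >= x0 the density is at least A / x times the tail, and the factor
x^(gamma - 1) is at least exp(- |gamma - 1| x^beta / beta) because
beta ln x <= x^beta. Below x0 the density is at least f x0. *)
Lemma stretched_exp_density_lb (f tl : R -> R) (x0 A B alpha beta gamma : R) :
  (forall x y, 0 <= x -> x <= y -> f y <= f x) ->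
  1 <= x0 -> 0 < A -> (forall x, x0 <= x -> A / x <= f x / tl x) ->
  0 < B -> 0 < alpha -> 0 < beta ->
  (forall x, x0 <= x -> B * x `^ gamma * expR (- (alpha * x `^ beta)) <= tl x) ->
  exists c a : R, [/\ 0 < c, 0 < a &
    forall x, 0 < x -> c * expR (- (a * x `^ beta)) <= f x].
Proof.
move=> fdec x01 A0 haz B0 alpha0 beta0 tlb.
pose a := alpha + `|gamma - 1| / beta.
have a0 : 0 < a by rewrite ltr_wpDr// divr_ge0// ltW.
pose c := A * B * expR (- (a * x0 `^ beta)).
have AB0 : 0 < A * B by rewrite mulr_gt0.
have c0 : 0 < c by rewrite mulr_gt0// expR_gt0.
have lbx x : x0 <= x -> A * B * expR (- (a * x `^ beta)) <= f x.
  move=> x0x; have x1 : 1 <= x by exact: le_trans x0x.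
  have xgt0 : 0 < x by exact: lt_le_trans x1.
  have tl0 : 0 < tl x.
    by apply: lt_le_trans (tlb _ x0x); rewrite !mulr_gt0 ?powR_gt0 ?expR_gt0.
  have := haz _ x0x; rewrite ler_pdivlMr// => /(le_trans _); apply.
  rewrite (@le_trans _ _
      (A / x * (B * x `^ gamma * expR (- (alpha * x `^ beta)))))//; last first.
    by rewrite ler_wpM2l ?tlb// divr_ge0// ltW.
  rewrite (_ : A / x * _ = A * B *
      (x `^ (gamma - 1) * expR (- (alpha * x `^ beta)))); last first.
    rewrite powRB ?(gt_eqF xgt0) ?implybT// powRr1 ?ltW//.
    by field; rewrite gt_eqF.
  rewrite ler_pM2l// /a mulrDl opprD expRD [leLHS]mulrC ler_wpM2r ?expR_ge0//.
  rewrite /powR gt_eqF// ler_expR.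
  have lnx0 : 0 <= ln x by exact: ln_ge0.
  have lnx : ln x <= expR (beta * ln x) / beta.
    rewrite ler_pdivlMr// mulrC (le_trans _ (expR_ge1Dx _))//.
    by rewrite lerDr.
  rewrite lerNl -mulNr (@le_trans _ _ (`|gamma - 1| * ln x))//.
    by rewrite ler_wpM2r// ler_normr lexx orbT.
  by rewrite -mulrA ler_wpM2l// mulrC.
exists c, a; split => // x xgt0.
have xb : 0 <= a * x `^ beta by rewrite mulr_ge0 ?powR_ge0 ?ltW.
have [x0x|xx0] := leP x0 x.
  apply: le_trans (lbx _ x0x); rewrite /c -mulrA ler_pM2l// mulrC ler_piMr ?expR_ge0//.
  by rewrite -expR0 ler_expR oppr_le0 mulr_ge0 ?powR_ge0 ?ltW.
apply: (@le_trans _ _ (f x0)); last by apply: fdec; exact: ltW.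
apply: le_trans (lbx _ (lexx _)); rewrite -/c ler_piMr ?(ltW c0)//.
by rewrite -expR0 ler_expR oppr_le0.
Qed.

Variables (nu : probability R R) (f : R -> R).
Hypotheses (fd : pos_density nu f).
Hypothesis fdec : forall x y, 0 <= x -> x <= y -> f y <= f x.

Lemma decreasing_density_itv (a b : R) : 0 <= a -> a < b ->
  (((b - a) * f b)%:E <= nu `]a, b]%classic)%E.
Proof.
move=> a0 ab; have [mf f0 nuE] := fd.
rewrite nuE//.
rewrite (_ : _ `&` _ = `]a, b]%classic); last first.
  apply/seteqP; split => x /=; rewrite !in_itv/= andbT; first by case.
  by move=> /andP[ax xb]; rewrite ax xb (le_lt_trans a0).
have b0 : 0 < b by exact: le_lt_trans ab.
apply: (@le_trans _ _ (\int[mu]_(x in `]a, b]) (f b)%:E)%E).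
  have muab : mu `]a, b]%classic = (b - a)%:E.
    by rewrite lebesgue_measure_itv/= lte_fin ab -EFinD.
  by rewrite integral_cst// mulrC EFinM -muab.
apply: ge0_le_integral => //.
- by move=> x _; rewrite lee_fin f0.
- apply/measurable_EFinP; apply: measurable_funS mf => // x /=.
  by rewrite !in_itv/= andbT => /andP[ax _]; exact: le_lt_trans ax.
- move=> x /=; rewrite in_itv/= => /andP[ax xb]; rewrite lee_fin fdec//.
  by rewrite (le_trans a0)// ltW.
Qed.

(** The mass of ]0, v] is at least v f v. *)
Lemma decreasing_density_le (v : R) : 0 < v -> v * f v <= 1.
Proof.
move=> v0; have := decreasing_density_itv (lexx 0) v0.
rewrite subr0 -lee_fin => /le_trans; apply.
exact: probability_le1.
Qed.

(** With w = t^(n+1), [mconv_density_mpow_ge] applied to the mass t f (2t) of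
[t, 2t] gives the lower bound f t (f (2t) / 2)^n, and both t^beta and (2t)^beta
are multiples of w^(beta / (n+1)). *)
Lemma mpow_stretched_exp_lb (c a beta : R) (n : nat) : nu `]0, +oo[%classic = 1%E ->
  0 < c -> 0 < a -> 0 < beta ->
  (forall x, 0 < x -> c * expR (- (a * x `^ beta)) <= f x) ->
  exists c' a' : R, [/\ 0 < c', 0 < a' & forall w, 0 < w ->
    c' * expR (- (a' * w `^ (beta / n.+1%:R))) <= mconv_density (mpow nu n) f w].
Proof.
move=> nuD c0 a0 beta0 flb.
pose a' := a + n%:R * (a * 2 `^ beta).
exists (c * (c / 2) ^+ n), a'; split.
- by rewrite mulr_gt0// exprn_gt0// divr_gt0.
- by rewrite ltr_wpDr// mulr_ge0// mulr_ge0 ?powR_ge0// (ltW a0).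
move=> w w0; pose t := w `^ n.+1%:R^-1.
have t0 : 0 < t by exact: powR_gt0.
have wE : w = t ^+ n.+1.
  by rewrite -powR_mulrn ?ltW// -powRrM mulVf ?powRr1 ?ltW// pnatr_eq0.
have tb : w `^ (beta / n.+1%:R) = t `^ beta by rewrite -powRrM mulrC.
rewrite tb wE.
have t20 : 0 < 2 * t by rewrite mulr_gt0.
have f20 : 0 <= f (2 * t) by have [_ f0 _] := fd; exact: f0.
have p0 : 0 <= t * f (2 * t) by rewrite mulr_ge0// ltW.
have pnu : ((t * f (2 * t)%R)%:E <= nu `[t%R, (2 * t)%R]%classic)%E.
  have tt : t < 2 * t by rewrite ltr_pMl// ltr1n.
  have := decreasing_density_itv (ltW t0) tt.
  rewrite (_ : 2 * t - t = t); last by ring.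
  move=> /le_trans; apply; apply: le_measure; rewrite ?inE//.
  exact: subset_itv_oc_cc.
apply: le_trans (mconv_density_mpow_ge n fd decreasing_density_le fdec t0 p0 pnu).
have -> : f t / (2 * t) ^+ n * (t * f (2 * t)) ^+ n = f t * (f (2 * t) / 2) ^+ n.
  rewrite -mulrA -exprVn -exprMn; congr (_ * _ ^+ _).
  by field; rewrite gt_eqF.
have -> : c * (c / 2) ^+ n * expR (- (a' * t `^ beta)) =
    (c * expR (- (a * t `^ beta))) *
    (c * expR (- (a * (2 * t) `^ beta)) / 2) ^+ n.
  set e2 := expR (- (a * (2 * t) `^ beta)).
  have -> : (c * e2 / 2) ^+ n = (c / 2) ^+ n * e2 ^+ n.
    by rewrite -exprMn mulrAC.
  rewrite /e2 /a' mulrDl opprD expRD powRM// ?(ltW t0)// -expRM_natl.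
  rewrite (_ : n%:R * - _ = - (n%:R * (a * 2 `^ beta) * t `^ beta)); last by ring.
  by ring.
apply: ler_pM; rewrite ?exprn_ge0 ?mulr_ge0 ?invr_ge0 ?expR_ge0 ?(ltW c0) ?flb//.
apply: lerXn2r; rewrite ?nnegrE ?mulr_ge0 ?invr_ge0 ?expR_ge0 ?(ltW c0)//.
by rewrite ler_wpM2r ?invr_ge0// flb.
Qed.

End decreasing_density.

(** * Finiteness of the Krein integral *)

Section krein_integral.
Context {R : realType}.
Local Notation mu := (@lebesgue_measure R).

(** The right-hand side is 2 / kappa times the derivative of atan (x^kappa), a
bounded function. Near 0 it is of order x^(kappa - 1), and near infinity of
order x^(- 1 - kappa). *)
Lemma powR_cauchy_le (kappa sigma x : R) : 0 < kappa -> kappa <= 1 ->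
  `|sigma| <= 1 - kappa -> 0 < x ->
  x `^ sigma / (1 + x ^+ 2) <=
  2 * (x `^ (kappa - 1) / (1 + (x `^ kappa) ^+ 2)).
Proof.
move=> k0 k1; rewrite ler_norml => /andP[s1 s2] x0.
have d1 : 0 < 1 + x ^+ 2 by rewrite ltr_wpDr// sqr_ge0.
have d2 : 0 < 1 + (x `^ kappa) ^+ 2 by rewrite ltr_wpDr// sqr_ge0.
rewrite ler_pdivrMr// [leRHS]mulrAC [leRHS]mulrA ler_pdivlMr//.
have xk0 : 0 < x `^ (kappa - 1) by exact: powR_gt0.
have [x1|x1] := leP x 1.
  rewrite (mulrC 2) -mulrA; apply: (@le_trans _ _ (x `^ (kappa - 1) * 2)).
    apply: ler_pM; rewrite ?powR_ge0// ?(ltW d2)//.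
      by rewrite ger_powR ?x0//; lra.
    rewrite (_ : 2 = 1 + 1 :> R)// lerD2l exprn_ile1 ?powR_ge0//.
    by rewrite -(powRr0 x) ger_powR ?x0// ltW.
  have px : 0 <= x `^ (kappa - 1) * x ^+ 2 by rewrite mulr_ge0 ?sqr_ge0// ltW.
  by nra.
have {}x1 := ltW x1.
apply: (@le_trans _ _ (x `^ (1 - kappa) * (1 + (x `^ kappa) ^+ 2))).
  by rewrite ler_wpM2r ?(ltW d2)// ler_powR.
rewrite [leRHS]mulrC.
apply: (@le_trans _ _ (2 * x `^ (1 + kappa))).
  rewrite mulrDr mulr1 -powR_mulrn ?powR_ge0// -powRrM.
  rewrite -powRD; last by rewrite (gt_eqF x0) implybT.
  have -> : 1 - kappa + kappa * 2 = 1 + kappa by ring.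
  rewrite mulr_natl mulr2n lerD2r ler_powR//; lra.
have -> : x `^ (1 + kappa) = x `^ (kappa - 1) * x ^+ 2.
  rewrite -powR_mulrn ?(ltW x0)// -powRD ?(gt_eqF x0) ?implybT//.
  by congr (_ `^ _); ring.
by nra.
Qed.

Lemma integrable_powR_cauchy (sigma : R) : `|sigma| < 1 ->
  mu.-integrable `]0, +oo[ (fun x => (x `^ sigma / (1 + x ^+ 2))%:E).
Proof.
move=> s1; pose kappa := 1 - `|sigma|.
have k0 : 0 < kappa by rewrite subr_gt0.
have k1 : kappa <= 1 by rewrite lerBlDr lerDl.
pose g (x : R) := kappa * (x `^ (kappa - 1) / (1 + (x `^ kappa) ^+ 2)).
have ig : mu.-integrable `]0, +oo[ (EFin \o g).
  apply: (@ge0_integrable_pos_derive _ (fun x => atan (x `^ kappa)) g (pi / 2)).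
  - move=> x x0; have d := is_derive1_powR kappa x0.
    have := @is_derive1_comp R atan (fun y => y `^ kappa) x _ _ (is_derive1_atan _) d.
    by move=> h; apply: is_derive_eq; rewrite /g [LHS]mulrC mulrA.
  - move=> x x0; apply: cvgM; first exact: cvg_cst.
    apply: cvgM; first exact: continuous_powR_pos.
    apply: cvgV; first by rewrite gt_eqF// ltr_wpDr// sqr_ge0.
    apply: cvgD; first exact: cvg_cst.
    rewrite expr2; under eq_fun do rewrite expr2.
    by apply: cvgM; exact: continuous_powR_pos.
  - move=> x x0; rewrite /g mulr_ge0 ?(ltW k0)//.
    by rewrite divr_ge0 ?powR_ge0 ?addr_ge0 ?sqr_ge0.
  - by move=> x x0; rewrite ler_norml !ltW ?atan_gtNpi2 ?atan_ltpi2.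
have mD : @measurable _ (measurableTypeR R) `]0%R, +oo[%classic.
  exact: measurable_itv.
have := integrableZl mD (2 / kappa) ig.
apply: le_integrable => //.
  apply/measurable_EFinP; apply: measurable_funTS.
  apply: measurable_funM; first exact: measurable_powR.
  apply: (measurableT_comp measurable_invr).
  by apply: measurable_funD => //; exact: measurable_funX.
move=> x /= /andP[x0 _]; rewrite lee_fin.
rewrite ger0_norm ?divr_ge0 ?powR_ge0 ?addr_ge0 ?sqr_ge0//.
rewrite (le_trans _ (ler_norm _))// /g mulrA divfK ?gt_eqF//.
by apply: powR_cauchy_le => //; rewrite /kappa opprB addrCA subrr addr0.
Qed.

Lemma measurable_lne_EFin d (T : measurableType d) (D : set T) (h : T -> R) :
  measurable D -> measurable_fun D h ->
  measurable_fun D (fun x => lne (h x)%:E).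
Proof.
move=> mD mh; rewrite /lne; apply: measurable_fun_if => //.
- exact: measurable_fun_ler.
- apply/measurable_EFinP; apply: (measurableT_comp (@measurable_ln R)).
  by apply: measurable_funS mh => //; exact: subIsetl.
Qed.

(** For almost all x > 0 the bounds give
2 ln x <= - ln (g (x^2)) <= |ln c| + a x^(2 rho). Moreover
- 2 ln x = 4 ln (x^(-1/2)) <= 4 x^(-1/2), and the three powers 0, 2 rho
and - 1/2 of x are integrable against 1 / (1 + x^2). *)
Lemma krein_fin_num (g : R -> R) (c a rho : R) :
  measurable_fun (`]0, +oo[%classic : set R) g ->
  0 < c -> 0 <= a -> 0 < rho -> rho < 2^-1 ->
  {ae mu, forall y, 0 < y -> c * expR (- (a * y `^ rho)) <= g y <= y^-1} ->
  krein g \is a fin_num.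
Proof.
move=> mg c0 a0 rho0 rho12 /ae_pos_sqr gb.
pose M (x : R) := `|ln c| * (x `^ 0 / (1 + x ^+ 2)) +
  a * (x `^ (2 * rho) / (1 + x ^+ 2)) + 4 * (x `^ (- 2^-1) / (1 + x ^+ 2)).
have mD : @measurable _ (measurableTypeR R) `]0%R, +oo[%classic.
  exact: measurable_itv.
have iM : mu.-integrable `]0, +oo[ (EFin \o M).
  have i1 : `|0 : R| < 1 by rewrite normr0.
  have i2 : `|2 * rho| < 1.
    by rewrite gtr0_norm ?mulr_gt0//; lra.
  have i3 : `|- 2^-1 : R| < 1 by rewrite normrN gtr0_norm ?invr_gt0//; lra.
  have j1 := integrableZl mD (`|ln c|) (integrable_powR_cauchy i1).
  have j2 := integrableZl mD a (integrable_powR_cauchy i2).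
  have j3 := integrableZl mD 4 (integrable_powR_cauchy i3).
  apply: eq_integrable (integrableD mD (integrableD mD j1 j2) j3) => // x _.
have mg2 : measurable_fun (`]0%R, +oo[%classic : set R) (fun x => g (x ^+ 2)).
  have mX : measurable_fun (`]0%R, +oo[%classic : set R) (fun x : R => x ^+ 2).
    exact: measurable_funX.
  apply: (measurable_comp _ _ mg mX) => //.
  move=> _ [x /= xD <-]; move: xD; rewrite !in_itv/= !andbT.
  exact: exprn_gt0.
have mV : measurable_fun (`]0%R, +oo[%classic : set R)
    (fun x : R => (1 + x ^+ 2)^-1).
  apply: measurable_funTS; apply: (measurableT_comp measurable_invr).
  by apply: measurable_funD => //; exact: measurable_funX.
have mu0 : measurable_fun (`]0%R, +oo[%classic : set (measurableTypeR R))
    (fun x : R => (- lne (g (x ^+ 2))%:E * ((1 + x ^+ 2)^-1)%:E)%E).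
  apply: emeasurable_funM; last exact/measurable_EFinP.
  by apply: measurableT_comp => //; exact: measurable_lne_EFin.
apply: integrable_fin_num => //; apply/integrableP; split => //.
have [mM iM'] := integrableP _ _ _ iM.
apply: le_lt_trans iM'; apply: ae_ge0_le_integral => //.
- exact: measurableT_comp.
- exact: measurableT_comp.
move: gb => [N [mN N0 sN]]; exists N; split => // x /= nx; apply: sN => /= gb.
apply: nx => /andP[x0 _]; have /andP[gl gu] := gb x0.
have g0 : 0 < g (x ^+ 2).
  by rewrite (lt_le_trans _ gl)// mulr_gt0 ?expR_gt0.
rewrite (leNgt (g (x ^+ 2))) g0/= lee_fin normrM normrN.
have x20 : 0 < x ^+ 2 by rewrite exprn_gt0.
have d0 : 0 < 1 + x ^+ 2 by rewrite ltr_wpDr// ltW.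
rewrite (ger0_norm (_ : 0 <= (1 + x ^+ 2)^-1)) ?invr_ge0 ?(ltW d0)//.
rewrite (le_trans _ (ler_norm _))// /M !mulrA -!mulrDl ler_wpM2r ?invr_ge0 ?(ltW d0)//.
rewrite powRr0 mulr1.
have lnl : ln c - a * x `^ (2 * rho) <= ln (g (x ^+ 2)).
  move: gl; rewrite -ler_ln ?posrE ?mulr_gt0 ?expR_gt0// lnM ?posrE ?expR_gt0// expRK.
  by rewrite -powR_mulrn ?(ltW x0)// -powRrM.
have lnu : ln (g (x ^+ 2)) <= 4 * x `^ (- 2^-1).
  apply: (@le_trans _ _ (ln (x ^+ 2)^-1)).
    by rewrite ler_ln ?posrE ?invr_gt0.
  rewrite (_ : (x ^+ 2)^-1 = (x `^ (- 2^-1)) ^+ 4); last first.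
    rewrite -[x ^+ 2]powR_mulrn ?(ltW x0)// -powRN -[RHS]powR_mulrn ?powR_ge0//.
    rewrite -powRrM.
    by congr (_ `^ _); field.
  have y0 : 0 < x `^ (- 2^-1) by exact: powR_gt0.
  by have := ln_sublinear y0; rewrite lnXn// => h; lra.
have m1 : 0 <= a * x `^ (2 * rho) by rewrite mulr_ge0 ?powR_ge0.
have m2 : 0 <= 4 * x `^ (- 2^-1) by rewrite mulr_ge0 ?powR_ge0.
have m3 : - ln c <= `|ln c| by rewrite -normrN ler_norm.
have m4 := normr_ge0 (ln c).
rewrite ler_norml; apply/andP; split; lra.
Qed.
End krein_integral.

(** * Moment indeterminacy *)

Section indeterminacy.
Context {R : realType}.
Local Notation mu := (@lebesgue_measure R).

Lemma pos_density_ext (m1 m2 : set R -> \bar R) (g : R -> R) :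
  (forall A, measurable A -> m2 A = m1 A) -> pos_density m1 g -> pos_density m2 g.
Proof. by move=> m12 [mg g0 m1E]; split => // A mA; rewrite m12// m1E. Qed.

Lemma pos_density_full (m : probability R R) (g : R -> R) (A : set R) :
  pos_density m g -> measurable A -> `]0, +oo[%classic `<=` A -> m A = 1%E.
Proof.
move=> [_ _ mE] mA DA; transitivity (m setT); last exact: probability_setT.
by rewrite !mE//; congr (integral _ _ _); rewrite setTI setIidr.
Qed.

Lemma pos_density_integrable (m : probability R R) (g : R -> R) :
  pos_density m g -> mu.-integrable `]0, +oo[ (EFin \o g).
Proof.
move=> gd; have [mg g0 mE] := gd; apply/integrableP; split.
  exact/measurable_EFinP.
rewrite (_ : (\int[mu]_(x in _) _)%E = 1%E) ?ltry//.
rewrite -(pos_density_full gd measurableT (@subsetT _ _)) mE// setTI.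
apply: eq_integral => x /set_mem/= /andP[x0 _].
by rewrite /= ger0_norm// g0.
Qed.

Lemma pos_density_ae_eq (m : probability R R) (g1 g2 : R -> R) :
  pos_density m g1 -> pos_density m g2 -> {ae mu, forall y, 0 < y -> g1 y = g2 y}.
Proof.
move=> gd1 gd2; have [mg1 _ mE1] := gd1; have [mg2 _ mE2] := gd2.
have mD : @measurable _ (measurableTypeR R) `]0%R, +oo[%classic.
  exact: measurable_itv.
have [|E ED mE|N [mN N0 sN]] := @integral_ae_eq _ _ _ mu _ mD (EFin \o g2)
    (EFin \o g1) (pos_density_integrable gd1).
- exact/measurable_EFinP.
- have EE : E `&` `]0, +oo[%classic = E by apply/setIidPl.
  by rewrite -[in LHS]EE -[in RHS]EE -mE1// -mE2.
exists N; split => // y /= ny; apply: sN => /= h; apply: ny => y0.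
by apply: EFin_inj; apply: h; rewrite in_itv/= y0.
Qed.

(** The power x^k is nonnegative on the half-line, which carries all the mass, so
that the formula for nonnegative functions applies to |x|^k. *)
Lemma pos_density_moment (m : probability R R) (g : R -> R) (k : nat) :
  pos_density m g ->
  (\int[m]_x (x ^+ k)%:E = \int[mu]_(x in `]0%R, +oo[) (x ^+ k * g x)%:E)%E.
Proof.
move=> gd; have mk : measurable_fun [set: R] (fun x : R => (x ^+ k)%:E).
  by apply/measurable_EFinP; exact: measurable_funX.
have mnk : measurable_fun [set: R] (fun x : R => (`|x| ^+ k)%:E).
  apply/measurable_EFinP; apply: measurable_funX; exact: normr_measurable.
have mC : m (~` `]0, +oo[%classic) = 0%E.
  by rewrite probability_setC// (pos_density_full gd)// subee.
transitivity (\int[m]_x (`|x| ^+ k)%:E)%E.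
  apply: ae_eq_integral => //; exists (~` `]0, +oo[%classic); split.
  - exact: measurableC.
  - exact: mC.
  - move=> x /= nx xD; apply: nx => _; move: xD; rewrite in_itv/= andbT => x0.
    by rewrite gtr0_norm.
rewrite (ge0_integral_pos_density gd mnk); last by move=> y; rewrite lee_fin exprn_ge0.
apply: eq_integral => x /set_mem/= /andP[x0 _].
by rewrite -EFinM gtr0_norm.
Qed.

(** The second law has density g + c h, where h comes from
[stieltjes_perturbation]; it is nonnegative because c |h| <= c exp(- a w^rho) <= g.
The two laws differ on an interval ]0, e[ on which h > 0. *)
Lemma stretched_exp_density_not_unique (m : probability R R) (g : R -> R)
    (c a rho : R) :
  pos_density m g -> (forall k, \int[m]_x (`|x| ^+ k)%:E < +oo)%E ->
  0 < c -> 0 < a -> 0 < rho -> rho < 2^-1 ->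
  (forall w, 0 < w -> c * expR (- (a * w `^ rho)) <= g w) ->
  exists nu : probability R R, [/\ nu `[0%R, +oo[%classic = 1%E,
    (forall k, \int[nu]_x (x ^+ k)%:E = \int[m]_x (x ^+ k)%:E)%E &
    exists2 A : set R, measurable A & nu A <> m A].
Proof.
move=> gd mmom c0 a0 rho0 rho12 glb; have [mg g0 mE] := gd.
have [p [q [ap q0 hmom]]] := stieltjes_perturbation a0 rho0 rho12.
pose h (x : R) := expR (- (p * x `^ rho)) * sin (q * x `^ rho).
have mh : measurable_fun [set: R] h.
  apply: measurable_funM.
    by have := @measurable_powR_expR R 0 p rho; under eq_fun do rewrite expr0 mul1r.
  apply: (measurableT_comp (continuous_measurable_fun (@continuous_sin R))).
  by apply: measurable_funM.
have h_le x : 0 < x -> `|h x| <= expR (- (a * x `^ rho)).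
  move=> x0; rewrite /h normrM (ger0_norm (expR_ge0 _)).
  rewrite -[leRHS]mulr1 ler_pM ?expR_ge0//.
    by rewrite ler_expR lerN2 ler_wpM2r ?powR_ge0.
  by rewrite ler_norml sin_geN1 sin_le1.
pose g1 x := g x + c * h x.
have g10 x : 0 < x -> 0 <= g1 x.
  move=> x0; rewrite /g1 -lerBlDr sub0r (le_trans _ (glb _ x0))//.
  rewrite -mulrN ler_wpM2l ?(ltW c0)// (le_trans _ (h_le _ x0))//.
  by rewrite -normrN ler_norm.
have mg1 : measurable_fun (`]0, +oo[%classic : set R) g1.
  apply: measurable_funD => //; apply: measurable_funM => //.
  exact: measurable_funTS.
pose g2 := g1 \_ `]0, +oo[.
have mg2 : measurable_fun [set: R] g2 by apply/(measurable_restrictT _ _).1.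
have g20 x : 0 <= g2 x.
  by rewrite /g2 patchE; case: ifPn => // /set_mem/= /andP[x0 _]; exact: g10.
have mD : @measurable _ (measurableTypeR R) `]0%R, +oo[%classic.
  exact: measurable_itv.
have ig k : mu.-integrable `]0, +oo[ (fun x => (x ^+ k * g x)%:E).
  apply/integrableP; split.
    by apply/measurable_EFinP; apply: measurable_funM => //; exact: measurable_funX.
  apply: le_lt_trans (mmom k); rewrite (ge0_integral_pos_density gd)//; last first.
    apply/measurable_EFinP; apply: measurable_funX; exact: normr_measurable.
  rewrite le_eqVlt; apply/predU1P; left; apply: eq_integral => x /set_mem/= /andP[x0 _].
  by rewrite normrM normrX [X in _ * X]ger0_norm// g0.
have ih k : mu.-integrable `]0, +oo[ (fun x => (x ^+ k * h x)%:E).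
  apply: le_integrable (integrable_stretched_exp k a0 rho0) => //.
    apply/measurable_EFinP; apply: measurable_funTS; apply: measurable_funM => //.
  move=> x /= /andP[x0 _]; rewrite lee_fin [leLHS]normrM [leRHS]normrM ler_wpM2l//.
  by rewrite (le_trans (h_le _ x0))// ler_norm.
have int_gh k : (\int[mu]_(x in `]0%R, +oo[) (x ^+ k * g1 x)%:E =
    \int[mu]_(x in `]0%R, +oo[) (x ^+ k * g x)%:E)%E.
  transitivity (\int[mu]_(x in `]0%R, +oo[)
      ((x ^+ k * g x)%:E + c%:E * (x ^+ k * h x)%:E))%E.
    by apply: eq_integral => x _; rewrite -EFinM -EFinD /g1 mulrDr mulrCA.
  rewrite integralD//; last exact: integrableZl.
  by rewrite integralZl// hmom mule0 adde0.
have mid : measurable_fun [set: measurableTypeR R] (idfun : measurableTypeR R -> R).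
  by move=> _ A mA; rewrite setTI.
pose cast : {measure set R -> \bar R} :=
  pushforward (mdensity mu mg2 g20) (idfun : measurableTypeR R -> R).
have castE (A : set R) : measurable A ->
    cast mid A = (\int[mu]_(x in A `&` `]0%R, +oo[) (g1 x)%:E)%E.
  move=> mA; rewrite integral_mkcondr; apply: eq_integral => x _.
  by rewrite restrict_EFin.
have cast1 : cast mid setT = 1%E.
  rewrite castE// setTI.
  transitivity (\int[mu]_(x in `]0%R, +oo[) (x ^+ 0 * g1 x)%:E)%E.
    by apply: eq_integral => x _; rewrite expr0 mul1r.
  rewrite int_gh -(pos_density_full gd measurableT (@subsetT _ _)) mE// setTI.
  by apply: eq_integral => x _; rewrite expr0 mul1r.
(* The mass is already 1; normalizing only provides the probability structure. *)
pose nu : probability R R := mnormalize (cast mid) m.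
have nuE A : nu A = cast mid A.
  by rewrite /nu/= /mnormalize cast1 onee_eq0/= invr1 mule1.
have nud : pos_density nu g1.
  by split => // A mA; rewrite nuE castE.
exists nu; split.
- apply: (pos_density_full nud) => // x /=; rewrite !in_itv/= !andbT.
  exact: ltW.
- by move=> k; rewrite (pos_density_moment _ nud) (pos_density_moment _ gd).
(* For x < e one has q x^rho < pi / 2. *)
pose e : R := (pi / 2 / q) `^ rho^-1.
have e0 : 0 < e by rewrite powR_gt0// !divr_gt0// pi_gt0.
have h_gt0 x : 0 < x -> x < e -> 0 < h x.
  move=> x0 xe; rewrite /h mulr_gt0 ?expR_gt0// sin_gt0_pihalf//.
  rewrite mulr_gt0 ?powR_gt0//= mulrC -ltr_pdivlMr//.
  have -> : pi / 2 / q = e `^ rho.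
    by rewrite /e -powRrM mulVf ?gt_eqF// powRr1// !divr_ge0 ?pi_ge0// ltW.
  by rewrite gt0_ltr_powR ?nnegrE ?(ltW x0) ?(ltW e0).
exists `]0, e[%classic => //.
have DE : `]0, e[%classic `&` `]0, +oo[%classic = `]0, e[%classic.
  by apply/setIidPl => x /= /andP[x0 _]; rewrite in_itv/= andbT.
rewrite nuE castE// mE// DE => H.
have mI : @measurable _ (measurableTypeR R) `]0%R, e[%classic.
  exact: measurable_itv.
have ID : `]0, e[%classic `<=` `]0, +oo[%classic.
  by move=> x /= /andP[x0 _]; rewrite in_itv/= andbT.
have ig' : mu.-integrable `]0, e[ (fun x => (g x)%:E).
  apply: integrableS (pos_density_integrable gd) => //.
have ih' : mu.-integrable `]0, e[ (fun x => (h x)%:E).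
  have := integrableS mD mI ID (ih 0).
  by apply: eq_integrable => // x _; rewrite expr0 mul1r.
have I0 : (\int[mu]_(x in `]0%R, e[) (h x)%:E = 0)%E.
  have : (\int[mu]_(x in `]0%R, e[) (g1 x)%:E =
      \int[mu]_(x in `]0%R, e[) (g x)%:E +
      c%:E * \int[mu]_(x in `]0%R, e[) (h x)%:E)%E.
    rewrite -integralZl// -integralD//; last exact: integrableZl.
  rewrite H.
  have gfin := integrable_fin_num mI ig'; have hfin := integrable_fin_num mI ih'.
  rewrite -(fineK gfin) -(fineK hfin) -EFinM -EFinD => -[] /eqP.
  rewrite -subr_eq0 opprD addrA subrr sub0r oppr_eq0 mulf_eq0 gt_eqF//=.
  by move=> /eqP ->.
have I1 : (\int[mu]_(x in `]0%R, e[) `|(h x)%:E| = 0)%E.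
  rewrite -[RHS]I0; apply: eq_integral => x /set_mem/= /andP[x0 xe].
  by rewrite gtr0_norm// h_gt0.
have mhI : measurable_fun (`]0%R, e[%classic : set (measurableTypeR R))
    (fun x => (h x)%:E).
  by case/integrableP : ih'.
have [N [mN N0 sN]] := (ae_eq_integral_abs mu mI mhI).1 I1.
have : (mu `]0%R, e[%classic <= mu N)%E.
  apply: le_measure; rewrite ?inE// => x /= xI; apply: sN => /= hx.
  have /andP[x0 xe] := xI.
  have hx0 : h x = 0 by apply: EFin_inj; exact: (hx xI).
  by have := h_gt0 x x0 xe; rewrite hx0 ltxx.
rewrite N0 leNgt lebesgue_measure_itv/= lte_fin e0 -EFinD subr0 lte_fin.
by rewrite e0.
Qed.

End indeterminacy.

(** * Products of independent copies *)

Theorem theorem5 (R : realType)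
    (d : measure_display) (T : measurableType d) (P : probability T R)
    (xi : {RV P >-> R}) (f : R -> R)
    (x0 A B alpha beta gamma : R)
    (xi_ge0 : nonneg_rv xi)
    (xi_moments : finite_moments xi)
    (f_density : is_density xi f)
    (f_gt0 : forall x : R, 0 <= x -> 0 < f x)
    (f_decr : forall x y : R, 0 <= x -> x <= y -> f y <= f x)
    (x0_ge1 : 1 <= x0) (A_gt0 : 0 < A)
    (hazard : forall x : R, x0 <= x -> A / x <= f x / tail xi x)
    (B_gt0 : 0 < B) (alpha_gt0 : 0 < alpha) (beta_gt0 : 0 < beta)
    (tail_lb : forall x : R, x0 <= x ->
       B * x `^ gamma * expR (- (alpha * x `^ beta)) <= tail xi x)
    (d' : measure_display) (T' : measurableType d') (P' : probability T' R)
    (n : nat) (n_ge1 : (1 <= n)%N)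
    (xis : 'I_n -> {RV P' >-> R})
    (xis_indep : mutually_independent xis)
    (xis_copies : forall i : 'I_n, same_law (xis i) xi)
    (n_gt : 2 * beta < n%:R) :
  finite_krein (prod_rv xis : {RV P' >-> R}) /\
  Mindet (prod_rv xis : {RV P' >-> R}).
Proof.
case: n n_ge1 xis xis_indep xis_copies n_gt => // n _ xis xis_indep xis_copies n_gt.
(* From here on there are n + 1 factors, n of which form the variable U. *)
pose Y : {RV P' >-> R} := prod_rv xis.
pose F : probability R R := distribution P xi.
pose m : probability R R := distribution P' Y.
have Fd : pos_density F f := f_density.
have FD : F `]0, +oo[%classic = 1%E by exact: (pos_density_full Fd).
have mE A' : measurable A' -> m A' = mpow F n.+1 A'.
  by move=> mA'; apply: law_prod => // i A'' mA''; exact: xis_copies.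
pose g := mconv_density (mpow F n) f.
have fub := decreasing_density_le Fd f_decr.
have gd : pos_density m g.
  apply: (pos_density_ext (m1 := mpow F n.+1)) => //.
  by apply: mconv_pos_density => //; exact: mpow_pos.
have [c1 [a1 [c10 a10 flb]]] := stretched_exp_density_lb f_decr x0_ge1 A_gt0
  hazard B_gt0 alpha_gt0 beta_gt0 tail_lb.
have [c [a [c0 a0 glb]]] := mpow_stretched_exp_lb Fd f_decr n FD c10 a10 beta_gt0 flb.
set rho := beta / n.+1%:R in glb.
have rho0 : 0 < rho by rewrite divr_gt0.
have rho12 : rho < 2^-1.
  by rewrite ltr_pdivrMr// mulrC ltr_pdivlMr// mulrC.
have mnorm k : measurable_fun [set: R] (fun y : R => (`|y| ^+ k)%:E).
  by apply/measurable_EFinP; apply: measurable_funX; exact: normr_measurable.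
have mmom k : (\int[m]_y (`|y| ^+ k)%:E < +oo)%E.
  rewrite (eq_measure_integral (mpow F n.+1)); last by move=> A' mA' _; exact: mE.
  apply: mpow_moment; rewrite /F ge0_integral_distribution//.
  have /integrableP[_] := xi_moments k.
  by under eq_integral do rewrite /= normrX.
have Ymom : finite_moments Y.
  move=> k; apply/integrableP; split.
    by apply/measurable_EFinP; apply: measurable_funX; exact: measurable_funPT.
  have := mmom k; rewrite /m ge0_integral_distribution//.
  by under [in X in _ -> X]eq_integral do rewrite /= normrX.
split; [split|split => //].
- by exists g.
- move=> g' g'd; have [mg' _ _] := g'd.
  apply: (krein_fin_num mg' c0 (ltW a0) rho0 rho12).
  have [N [mN N0 sN]] := pos_density_ae_eq gd g'd.
  exists N; split => // y /= ny; apply: sN => /= gg'; apply: ny => y0.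
  by rewrite -gg'// glb// (mconv_density_le _ Fd fub).
- by apply: (pos_density_full gd) => // x /=; rewrite !in_itv/= !andbT; exact: ltW.
have [nu [nu0 nuk [A' mA' nuA]]] :=
  stretched_exp_density_not_unique gd mmom c0 a0 rho0 rho12 glb.
move=> Ydet; apply: nuA; apply: Ydet => // k.
rewrite nuk unlock /m integral_distribution//; last exact: (Ymom k).
by apply/measurable_EFinP; exact: measurable_funX.
Qed.
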